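(* For every $1\leq p\leq2$, we have $$\Gamma_{\rm iid}(\exp(L_p)_0)=\Gamma_{\rm i}(\exp(L_p)_0)=[1,2].$$ For every $2\leq p<\infty$, we have $$\Gamma_{\rm iid}(\exp(L_p)_0)=\Gamma_{\rm i}(\exp(L_p)_0)=\Big[1,\frac{p}{p-1}\Big].$$
   Context: For $1\le p<\infty$ let $N_p(u)=e^{u^p}-1$; $\exp(L_p)$ is the Orlicz space $L_{N_p}$ on $[0,1]$ (Lebesgue measure), i.e. the space of $x\in L_1[0,1]$ with $\|x\|=\inf\{\lambda>0:\int_0^1N_p(|x(t)|/\lambda)\,dt\le1\}<\infty$. $\exp(L_p)_0$ denotes its separable part, i.e. the closure of $L_\infty[0,1]$ in $\exp(L_p)$. Let $E$ be a Banach space of measurable functions on $[0,1]$ and $p\ge1$. A bounded sequence $\{x_n\}\subset E$ is a $p$-BS-sequence if for every subsequence $\{y_k\}\subset\{x_n\}$ one has $\sup_{m\in\mathbb N}m^{-1/p}\|\sum_{k=1}^my_k\|_E<\infty$. $\Gamma_{\rm i}(E)$ (respectively $\Gamma_{\rm iid}(E)$) is the set of all $p\ge1$ such that every weakly null sequence in $E$ of independent random variables (respectively, of independent identically distributed random variables) contains a subsequence which is a $p$-BS-sequence. *)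

(* Defs.v *)
From HB Require Import structures.
From mathcomp Require Import all_boot all_order all_algebra.
From mathcomp Require Import all_classical all_reals all_analysis.

Set Implicit Arguments.
Unset Strict Implicit.
Unset Printing Implicit Defensive.

Import Order.TTheory GRing.Theory Num.Theory.
Import numFieldNormedType.Exports.

Local Open Scope classical_set_scope.
Local Open Scope ring_scope.

(* The probability space [0,1]: Lebesgue measure on R, restricted to [0,1].
   Functions on [0,1] are represented by functions R -> R; their values outside
   [0,1], which is a null set here, play no role. *)
Definition leb01 (R : realType) : set (measurableTypeR R) -> \bar R :=
  mrestr (@lebesgue_measure R) (measurable_itv `[0, 1]).
Arguments leb01 R : clear implicits.

HB.instance Definition _ (R : realType) := Measure.on (leb01 R).

Fact leb01_setT (R : realType) : leb01 R [set: _] = 1%E.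
Proof.
by rewrite /leb01 /mrestr setTI lebesgue_measure_itv/= lte01 oppr0 adde0.
Qed.

HB.instance Definition _ (R : realType) :=
  Measure_isProbability.Build _ _ _ (leb01 R) (@leb01_setT R).

(* A space of measurable functions on [0,1].  Its elements are functions rather
   than classes modulo a.e. equality, so that the norm of the Banach space is a
   seminorm here; it is finite on the carrier, and its values outside the carrier
   are not significant. *)
Record fun_space (R : realType) := FunSpace {
  fcarrier : set (measurableTypeR R -> R);
  fnorm : (measurableTypeR R -> R) -> \bar R }.

Section orlicz.
Context (R : realType).
Implicit Types (N : R -> R) (x y : measurableTypeR R -> R).

Definition luxemburg_norm N x : \bar R :=
  ereal_inf [set l%:E | l in [set l : R | 0 < l /\
    (\int[leb01 R]_t (N (`|x t| / l))%:E <= 1)%E]].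

Definition orlicz_space N : fun_space R :=
  FunSpace [set x | x \in Lfun (leb01 R) 1%E /\ (luxemburg_norm N x < +oo)%E]
           (luxemburg_norm N).

Definition expN (p u : R) : R := expR (u `^ p) - 1.

Definition expL (p : R) : fun_space R := orlicz_space (expN p).

Definition expL0 (p : R) : fun_space R :=
  FunSpace [set x | fcarrier (expL p) x /\ forall e : R, 0 < e ->
              exists2 y, y \in Lfun (leb01 R) +oo%E &
                (fnorm (expL p) (x \- y)%R < e%:E)%E]
           (fnorm (expL p)).

End orlicz.

Section banach_saks.
Context (R : realType).
Implicit Types (E : fun_space R) (x : nat -> measurableTypeR R -> R).

(* Boundedness makes f vanish on functions of seminorm 0, so f is exactly an
   element of the dual of the Banach space of classes. *)
Definition bounded_functional E (f : (measurableTypeR R -> R) -> R) : Prop :=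
  (forall (a : R) y z, fcarrier E y -> fcarrier E z ->
    f (a \*o y \+ z) = a * f y + f z) /\
  (exists C : R, forall y, fcarrier E y -> (`|f y|%:E <= C%:E * fnorm E y)%E).

Definition weakly_null E x : Prop :=
  (forall n, fcarrier E (x n)) /\
  forall f, bounded_functional E f -> f (x n) @[n --> \oo] --> 0.

Definition independent_seq x : Prop :=
  forall (J : seq nat) (B : nat -> set R), uniq J ->
    (forall n, measurable (B n)) ->
    leb01 R (\bigcap_(n in [set` J]) x n @^-1` B n) =
    (\prod_(n <- J) leb01 R (x n @^-1` B n))%E.

Definition identically_distributed x : Prop :=
  forall (m n : nat) (B : set R), measurable B ->
    leb01 R (x m @^-1` B) = leb01 R (x n @^-1` B).

Definition BS_sequence E (q : R) x : Prop :=
  [/\ forall n, fcarrier E (x n),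
      (ereal_sup (range (fun n => fnorm E (x n))) < +oo)%E &
      forall s : nat -> nat, increasing_seq s ->
        (ereal_sup (range (fun m : nat => (m.+1%:R `^ (- q^-1))%:E *
           fnorm E (fun t => (\sum_(k < m.+1) x (s k) t)%R)))
         < +oo)%E].

Definition has_BS_subsequence E (q : R) x : Prop :=
  exists2 s : nat -> nat, increasing_seq s & BS_sequence E q (x \o s).

Definition Gamma_i E : set R :=
  [set q | 1 <= q /\ forall x, weakly_null E x -> independent_seq x ->
             has_BS_subsequence E q x].

Definition Gamma_iid E : set R :=
  [set q | 1 <= q /\ forall x, weakly_null E x -> independent_seq x ->
             identically_distributed x -> has_BS_subsequence E q x].

End banach_saks.

(* Main.v *)
Require Import Defs.
From mathcomp Require Import all_boot all_order all_algebra.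
From mathcomp Require Import all_classical all_reals all_analysis.
From mathcomp Require Import measurable_realfun ess_sup_inf.
From mathcomp Require Import zify ring lra.

Set Implicit Arguments.
Unset Strict Implicit.
Unset Printing Implicit Defensive.

Import Order.TTheory GRing.Theory Num.Theory.
Import numFieldNormedType.Exports.
Local Open Scope classical_set_scope.
Local Open Scope ring_scope.

(** Write k for max(1/2, 1 - 1/p), so that 1/k is the right end point of the
    two intervals.  Both inclusions come from one fact: sums of m independent
    centred variables that are bounded in exp(L_p) have norm of order at most
    m^k, and the Rademacher functions attain this order.

    For the bound (mgf_sum, luxemburg_norm_sum_le), let S be the sum, put
    T = m^(-k) S and estimate the exponential moments of a v^(p-1) |T| for
    v >= 0, with a small.  With w = v m^(-1/p) the coefficient of S is at most
    a w^(p-1), while m w^p = v^p.  If w >= 4, Young's inequality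
    w^(p-1) |y| <= w^p / 4 + 4^(p-1) |y|^p, applied to each summand y, is enough
    (mgf_large).  If w <= 4, the coefficient is small and the summands being
    centred gives a quadratic bound (mgf_small), whose total over m summands is
    of order v^p by the choice of k.  In both cases the exponential moment is at
    most C exp(a v^p / 2).  Since exp(b |T|^p) is dominated by a series of terms
    exp(b - 3/4 a n^p) exp(a n^(p-1) |T|) over the integers n
    (expR_floor_bound), integrating term by term bounds exp(b |T|^p) in mean,
    hence the norm of T.  Arguing with v rather than with the dual exponent of p
    treats p = 1 and p > 1 at once.

    A weakly null sequence is bounded, and its means tend to 0.  Boundedness
    (weakly_null_bounded) is the uniform boundedness principle, which is
    derived here by a gliding hump (gliding_hump) from explicit functionals
    that norm a given function up to a factor (norming_functional).  A
    subsequence with summable means is then a 1/k-BS-sequence, and so a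
    q-BS-sequence for every q <= 1/k (sub_Gamma_i).

    Conversely the Rademacher functions are independent and identically
    distributed.  They are weakly null because k < 1: a functional which is at
    least e in absolute value on infinitely many of them would be at least m e
    on a signed sum of m of them, against the bound m^k on its norm
    (rademacher_weakly_null).  Every sum S of m of them has norm at least
    c m^k, because the mean of exp(x S) is exactly cosh(x)^m
    (rademacher_sum_lower); this excludes q > 1/k. *)

(** * Inequalities for powers and exponentials *)

Section real_inequalities.
Context {R : realType}.
Implicit Types a b p t u v w x y : R.

(** The linear term is kept exactly: for a centred variable it integrates to 0,
    and only the quadratic remainder contributes to the exponential moment. *)
Lemma expR_le_taylor2 x : expR x <= 1 + x + x ^+ 2 * expR `|x|.
Proof.
have slope (z : R) : expR z - 1 <= z * expR z.
  have := expR_ge1Dx (- z); rewrite expRN => h.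
  have := ler_wpM2r (expR_ge0 z) h.
  by rewrite mulVf ?gt_eqF ?expR_gt0// mulrDl mul1r mulNr; lra.
have /orP[x0|x0] := le_total 0 x.
- rewrite ger0_norm//; have h := slope x.
  have := ler_wpM2l x0 h; rewrite expr2; lra.
- rewrite ler0_norm//; have h := slope x.
  have h1 : 1 <= expR (- x) by rewrite -expR0 ler_expR; lra.
  have h2 := expR_ge1Dx x.
  have h3 : - x * (1 - expR x) <= - x * - x by apply: ler_wpM2l; lra.
  have h4 : x ^+ 2 * 1 <= x ^+ 2 * expR (- x) by rewrite ler_wpM2l// sqr_ge0.
  rewrite expr2 in h4 *; lra.
Qed.

Lemma sqr_le_expR x : x ^+ 2 <= 16 * expR (`|x| / 2).
Proof.
have -> : `|x| / 2 = 2%:R * (`|x| / 4) by field.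
rewrite expRM_natl.
have h : `|x| / 4 <= expR (`|x| / 4).
  by apply: le_trans (expR_ge1Dx _); rewrite lerDr.
have : (`|x| / 4) ^+ 2 <= expR (`|x| / 4) ^+ 2.
  by rewrite lerXn2r// nnegrE ?expR_ge0// divr_ge0.
rewrite expr_div_n real_normK ?num_real//; lra.
Qed.

Lemma le_1DpowR p u : 1 <= p -> 0 <= u -> u <= 1 + u `^ p.
Proof.
move=> p1 u0; have /orP[u1|u1] := le_total u 1.
  by rewrite (le_trans u1)// lerDl powR_ge0.
by rewrite (le_trans (le1r_powR u1 p1))// lerDr.
Qed.

(** The quadratic factor and the factor expR `|t * x| of the remainder are each
    absorbed into expR (`|x| / 2), and `|x| <= 1 + `|x| `^ p. *)
Lemma mgf_pointwise p t x : 1 <= p -> `|t| <= 1 / 2 ->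
  expR (t * x) <= 1 + t * x + t ^+ 2 * (16 * expR 1 * expR (`|x| `^ p)).
Proof.
move=> p1 t2; apply: (le_trans (expR_le_taylor2 _)).
rewrite lerD2l exprMn -[leLHS]mulrA; apply: ler_wpM2l; first exact: sqr_ge0.
have h : expR `|t * x| <= expR (`|x| / 2).
  by rewrite ler_expR normrM mulrC ler_wpM2l//; lra.
have h1 : expR (`|x| / 2) * expR (`|x| / 2) <= expR 1 * expR (`|x| `^ p).
  rewrite -!expRD ler_expR.
  by have := le_1DpowR p1 (normr_ge0 x); lra.
apply: (le_trans (ler_pM (sqr_ge0 _) (expR_ge0 _) (sqr_le_expR x) h)).
by rewrite -!mulrA ler_pM2l.
Qed.

(** Young's inequality with exponents p/(p-1) and p and without sharp constants:
    one of the two terms on the right dominates according as k * u <= w or not.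
    In this form it makes sense for p = 1 too. *)
Lemma powR_young p k u w : 1 <= p -> 0 < k -> 0 <= u -> 0 <= w ->
  w `^ (p - 1) * u <= w `^ p / k + k `^ (p - 1) * u `^ p.
Proof.
move=> p1 k0 u0 w0; have p0 : 0 < p by lra.
have /orP[h|h] := le_total (k * u) w.
- apply: (@le_trans _ _ (w `^ p / k)); last first.
    by rewrite lerDl mulr_ge0// powR_ge0.
  rewrite -(mulr_powRB1 w0 p0) -[leRHS]mulrA mulrCA ler_wpM2l ?powR_ge0//.
  by rewrite ler_pdivlMr// mulrC.
- apply: (@le_trans _ _ (k `^ (p - 1) * u `^ p)); last first.
    by rewrite lerDr divr_ge0 ?powR_ge0// ltW.
  rewrite -(mulr_powRB1 u0 p0) (mulrC u) mulrA ler_wpM2r//.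
  rewrite -powRM ?(ltW k0)// ge0_ler_powR ?nnegrE ?subr_ge0//.
  by rewrite mulr_ge0 ?(ltW k0).
Qed.

(** Convexity of the exponential between 0 and u, from the tangent at a * u. *)
Lemma expR_chord a u : 0 <= a <= 1 -> expR (a * u) <= 1 + a * (expR u - 1).
Proof.
move=> /andP[a0 a1].
have tangent z : expR (a * u) * (1 + (z - a * u)) <= expR z.
  rewrite -[leRHS](_ : expR (a * u) * expR (z - a * u) = _); last first.
    by rewrite -expRD; congr expR; ring.
  by rewrite ler_wpM2l ?expR_ge0// expR_ge1Dx.
have := ler_wpM2l a0 (tangent u).
have := @ler_wpM2l _ (1 - a) _ _ _ (tangent 0); rewrite expR0 subr_ge0 => /(_ a1).
set E := expR (a * u); set E1 := expR u; lra.
Qed.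

(** Take n to be the integer part of t: then a t^p is at least a n^p, and the
    scale b is so small that b t^p <= b (n + 1)^p <= b + a n^p / 4.  The bound
    turns exponential moments, which factor over independent variables, into an
    integral of exp(b t^p), which does not. *)
Lemma expR_floor_bound p a t : 1 <= p -> 0 < a -> 0 <= t ->
  let b := a / (4 * 2 `^ p) in
  exists n : nat, expR (b * t `^ p) <=
    expR (b - 3 / 4 * a * n%:R `^ p) * expR (a * n%:R `^ (p - 1) * t).
Proof.
move=> p1 a0 t0 b; have p0 : 0 < p by lra.
have b0 : 0 < b by rewrite divr_gt0// mulr_gt0// powR_gt0.
exists (Num.truncn t); set n := Num.truncn t.
have /andP[nt tn] : n%:R <= t < n.+1%:R by exact: truncn_itv.
rewrite -expRD ler_expR.
have h1 : a * n%:R `^ p <= a * n%:R `^ (p - 1) * t.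
  by rewrite -mulrA ler_pM2l// -(mulr_powRB1 _ p0)// mulrC ler_wpM2l ?powR_ge0.
have h2 : b * t `^ p <= b * n.+1%:R `^ p.
  by rewrite ler_pM2l// ge0_ler_powR ?nnegrE ?(ltW p0) ?(ltW tn).
have h3 : b * n.+1%:R `^ p <= b + a / 4 * n%:R `^ p.
  case: (posnP n) => [->|n0].
    by rewrite powR1 mulr1 lerDl mulr_ge0 ?powR_ge0// divr_ge0// ltW.
  apply: (@le_trans _ _ (b * (2 * n%:R) `^ p)).
    rewrite ler_pM2l// ge0_ler_powR ?nnegrE ?(ltW p0)// ?mulr_ge0//.
    by rewrite -natrM ler_nat; lia.
  rewrite powRM// mulrA.
  have -> : b * 2 `^ p = a / 4.
    by rewrite /b; field; rewrite gt_eqF// powR_gt0.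
  by rewrite lerDr ltW.
set N := n%:R `^ p in h1 h3 *; set Y := t `^ p in h2 *.
set Z := n.+1%:R `^ p in h2 h3 *; lra.
Qed.

End real_inequalities.

(** * Independence and products *)

Section decoupling.
Context d d' (T : measurableType d) (U : measurableType d') (R : realType).
Variable mu : {measure set T -> \bar R}.
Import HBNNSimple.

(** Independence of a weight h and a variable X, tested on events of X only,
    extends to nonnegative functions of X by simple approximation. *)
Lemma integral_decouple (X : T -> U) (h : T -> R) (c : R) (g : U -> R) :
  measurable_fun setT X -> measurable_fun setT h -> (forall t, 0 <= h t) ->
  measurable_fun setT g -> (forall r, 0 <= g r) -> 0 <= c ->
  (forall B, measurable B ->
     (\int[mu]_t (h t * \1_B (X t))%:E = c%:E * mu (X @^-1` B))%E) ->
  (\int[mu]_t (h t * g (X t))%:E = c%:E * \int[mu]_t (g (X t))%:E)%E.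
Proof.
move=> mX mh h0 mg g0 c0 H.
have mG := (measurable_EFinP setT g).2 mg.
pose f_ := nnsfun_approx measurableT mG.
have mf n : measurable_fun setT (fun t => f_ n (X t)).
  by apply: measurableT_comp.
have cvgf t : (f_ n (X t))%:E @[n --> \oo] --> (g (X t))%:E.
  by apply: (@cvg_nnsfun_approx _ _ _ _ _ _ mG) => // y _; rewrite lee_fin.
have ndf t : {homo (fun n => f_ n (X t)) : m n / (m <= n)%N >-> m <= n}.
  by move=> m n mn; exact/lefP/nd_nnsfun_approx.
have simple n : (\int[mu]_t (h t * f_ n (X t))%:E
    = c%:E * \int[mu]_t (f_ n (X t))%:E)%E.
  have mfX r : measurable (X @^-1` (f_ n @^-1` [set r])).
    by rewrite -[X in measurable X]setTI; exact: mX.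
  have mI r : measurable_fun setT (fun t => \1_(f_ n @^-1` [set r]) (X t) : R).
    by apply: measurableT_comp.
  transitivity (\sum_(k \in range (f_ n))
      \int[mu]_t (k * (h t * \1_(f_ n @^-1` [set k]) (X t)))%:E)%E.
    rewrite -ge0_integral_fsum//=; last 2 first.
    - move=> r; apply/measurable_EFinP; apply: measurable_funM => //.
      exact: measurable_funM.
    - move=> r t _.
      have := nnfun_muleindic_ge0 (f_ n) r (X t).
      rewrite -EFinM !lee_fin => k0.
      by rewrite mulrCA mulr_ge0// .
    apply: eq_integral => t _; rewrite fsumEFin//; congr EFin.
    rewrite (fimfunE (f_ n)) mulr_fsumr//.
    by apply: eq_fsbigr => r _; rewrite mulrCA.
  transitivity (c%:E * \sum_(k \in range (f_ n))
      \int[mu]_t (k * \1_(f_ n @^-1` [set k]) (X t))%:E)%E; last first.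
    congr (_ * _)%E; rewrite -ge0_integral_fsum//=; last 2 first.
    - by move=> r; apply/measurable_EFinP; apply: measurable_funM.
    - by move=> r t _; have := nnfun_muleindic_ge0 (f_ n) r (X t); rewrite -EFinM.
    by apply: eq_integral => t _; rewrite fsumEFin// (fimfunE (f_ n)).
  rewrite ge0_mule_fsumr; last first.
    move=> r; apply: integral_ge0 => t _.
    by have := nnfun_muleindic_ge0 (f_ n) r (X t); rewrite -EFinM.
  apply: eq_fsbigr => r; rewrite inE => -[u _ <-].
  set s := f_ n u; have s0 : 0 <= s by [].
  under eq_integral do rewrite EFinM.
  rewrite ge0_integralZl_EFin//; last 2 first.
  - by move=> t _; rewrite lee_fin mulr_ge0.
  - by apply/measurable_EFinP; exact: measurable_funM.
  rewrite H//; under [in RHS]eq_integral do rewrite EFinM.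
  rewrite ge0_integralZl_EFin//; last first.
    exact/measurable_EFinP.
  rewrite muleCA; congr (_ * (_ * _))%E.
  by rewrite (integral_indic _ _ (mfX s)) ?setIT.
transitivity (limn (fun n => \int[mu]_t (h t * f_ n (X t))%:E)%E).
  rewrite -monotone_convergence//.
  - apply: eq_integral => t _; apply/esym/cvg_lim => //.
    under eq_fun do rewrite EFinM.
    by rewrite EFinM; apply: cvgeZl.
  - by move=> n; apply/measurable_EFinP; exact: measurable_funM.
  - by move=> n t _; rewrite lee_fin mulr_ge0.
  - by move=> t _ m n mn; rewrite lee_fin ler_wpM2l// ndf.
have -> : (\int[mu]_t (g (X t))%:E = limn (fun n => \int[mu]_t (f_ n (X t))%:E))%E.
  rewrite -monotone_convergence//.
  - by apply: eq_integral => t _; apply/esym/cvg_lim.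
  - by move=> n; exact/measurable_EFinP.
  - by move=> n t _; rewrite lee_fin.
  - by move=> t _ m n mn; rewrite lee_fin ndf.
under eq_fun do rewrite simple.
rewrite limeMl//.
apply: ereal_nondecreasing_is_cvgn => m n mn; apply: ge0_le_integral => //.
- by move=> t _; rewrite lee_fin.
- exact/measurable_EFinP.
- exact/measurable_EFinP.
- by move=> t _; rewrite lee_fin ndf.
Qed.

End decoupling.

Section independent_products.
Context (R : realType).
Notation T := (measurableTypeR R).
Notation mu := (leb01 R).
Implicit Types x : nat -> T -> R.

(** The defining identity for finitely many indices is an instance of the one
    for x, after transporting the events back along an inverse of s. *)
Lemma independent_comp x (s : nat -> nat) (g : nat -> R -> R) :
  injective s -> (forall n, measurable_fun setT (g n)) ->
  independent_seq x -> independent_seq (fun n => g n \o x (s n)).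
Proof.
move=> s_inj mg ix J B uJ mB.
have [s' sK] : exists s' : nat -> nat, cancel s s'.
  exists (fun n => if pselect (exists k, s k = n) is left P
                   then projT1 (cid P) else 0%N) => k.
  case: pselect => [P|[]]; last by exists k.
  by apply: s_inj; case: (cid P).
have := ix (map s J) (fun n => g (s' n) @^-1` B (s' n)).
rewrite map_inj_uniq// => /(_ uJ).
have mgB n : measurable (g n @^-1` B n) by rewrite -[X in measurable X]setTI; exact: mg.
move=> /(_ (fun n => mgB _)).
rewrite big_map => e.
transitivity (\prod_(j <- J) mu (x (s j) @^-1` (g (s' (s j)) @^-1` B (s' (s j)))))%E; last first.
  by apply: eq_bigr => j _; rewrite sK.
rewrite -e; congr (mu _); apply/seteqP; split => t /=.
- by move=> H _ /mapP[j jJ ->] /=; rewrite sK; exact: H.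
- by move=> H j jJ; have := H (s j); rewrite /= mem_map// sK; exact.
Qed.

(** Indicators are replaced by g one factor at a time: after j steps the first j
    factors are g (x k) and the others are indicators of arbitrary events, so the
    next factor can be treated with integral_decouple. *)
Lemma integral_prod_independent x (g : R -> R) m :
  (forall n, measurable_fun setT (x n)) -> independent_seq x ->
  measurable_fun setT g -> (forall r, 0 <= g r) ->
  (forall n, (\int[mu]_t (g (x n t))%:E < +oo)%E) ->
  (\int[mu]_t (\prod_(k < m) g (x k t))%:E
    = \prod_(k < m) \int[mu]_t (g (x k t))%:E)%E.
Proof.
move=> mx ix mg g0 gfin.
have mxB n B : measurable B -> measurable (x n @^-1` B).
  by move=> mB; rewrite -[X in measurable X]setTI; exact: mx.
pose F j (B : nat -> set R) (k : nat) t : R :=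
  if (k < j)%N then g (x k t) else \1_(B k) (x k t).
pose c j (B : nat -> set R) k : R :=
  if (k < j)%N then fine (\int[mu]_t (g (x k t))%:E) else fine (mu (x k @^-1` B k)).
have Eg n : ((fine (\int[mu]_t (g (x n t))%:E))%:E = \int[mu]_t (g (x n t))%:E)%E.
  by rewrite fineK// ge0_fin_numE// integral_ge0// => t _; rewrite lee_fin.
have muE A : measurable A -> ((fine (mu A))%:E = mu A)%E.
  by move=> mA; rewrite fineK// fin_num_measure.
(* Hybrid claim: g in the first j factors, indicators of the B k in the others. *)
suff main j : (j <= m)%N -> forall B, (forall k, measurable (B k)) ->
    (\int[mu]_t (\prod_(k < m) F j B k t)%:E = (\prod_(k < m) c j B k)%:E)%E.
  have := main m (leqnn m) (fun=> setT) (fun=> measurableT).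
  under eq_integral do under eq_bigr do rewrite /F ltn_ord.
  by under eq_bigr do rewrite /c ltn_ord; move=> ->; rewrite -prodEFin; apply: eq_bigr.
elim: j => [_ B mB|j IH jm B mB].
  have -> : (\prod_(k < m) c 0 B k)%:E = mu (\bigcap_(n in [set` iota 0 m]) x n @^-1` B n).
    rewrite (ix _ _ (iota_uniq _ _) mB) -prodEFin /c/=.
    have -> : iota 0 m = index_iota 0 m by rewrite /index_iota subn0.
    rewrite big_mkord.
    by apply: eq_bigr => k _; apply: muE; exact: mxB.
  rewrite -[X in mu X]setIT -integral_indic//; last first.
    by apply: fin_bigcap_measurable => // k _; exact: mxB.
  apply: eq_integral => t _; congr EFin; rewrite /F/=.
  have [Bt|/existsNP[k /not_implyP[km nBt]]] :=
      pselect (forall k, (k < m)%N -> B k (x k t)).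
    rewrite big1 => [|k _]; last by rewrite indicE mem_set//; exact: Bt.
    rewrite indicE mem_set// => k /=; rewrite mem_iota add0n => /andP[_].
    exact: Bt.
  rewrite (bigD1 (Ordinal km))//= indicE memNset// mul0r indicE memNset//.
  by move=> /(_ k); rewrite /= mem_iota add0n => /(_ km).
have mF j' B' k : (forall k, measurable (B' k)) -> measurable_fun setT (F j' B' k).
  move=> mB'; rewrite /F; case: (k < j')%N; first exact: (measurableT_comp mg (mx k)).
  have mI : measurable_fun setT (\1_(B' k) : R -> R) by exact: measurable_indic.
  exact: (measurableT_comp mI (mx k)).
have F0 j' B' k t : 0 <= F j' B' k t by rewrite /F; case: ifP.
pose jo := Ordinal jm.
pose h t := \prod_(k < m | k != jo) F j B k t.
pose d := \prod_(k < m | k != jo) c j B k.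
have FS (k : 'I_m) t : k != jo -> F j.+1 B k t = F j B k t.
  by rewrite -val_eqE/= /F ltnS leq_eqVlt => /negbTE ->.
have cS (k : 'I_m) : k != jo -> c j.+1 B k = c j B k.
  by rewrite -val_eqE/= /c ltnS leq_eqVlt => /negbTE ->.
transitivity (\int[mu]_t (h t * g (x j t))%:E)%E.
  apply: eq_integral => t _; rewrite (bigD1 jo)//= mulrC.
  congr (_ * _)%:E; first by apply: eq_bigr => k kj; rewrite FS.
  by rewrite /F ltnS leqnn.
rewrite (bigD1 jo)//= {1}/c ltnS leqnn mulrC EFinM Eg.
rewrite (eq_bigr (fun k : 'I_m => c j B k)) => [|k /cS//]; rewrite -/d.
apply: integral_decouple => //.
- have -> : h = fun t => \prod_(k <- [seq k <- index_enum _ | k != jo]) F j B k t.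
    by apply/funext => t; rewrite big_filter.
  by apply: measurable_prod => k _; exact: mF.
- by move=> t; apply: prodr_ge0 => k _.
- apply: prodr_ge0 => k _; rewrite /c; case: ifP => _; rewrite fine_ge0//.
  by apply: integral_ge0 => t _; rewrite lee_fin.
move=> C mC.
pose B' k := if k == j then C else B k.
have mB' k : measurable (B' k) by rewrite /B'; case: ifP.
have := IH (ltnW jm) B' mB'.
rewrite (bigD1 jo)//= {1}/c ltnn /B' eqxx EFinM muE; last exact: mxB.
rewrite (eq_bigr (fun k : 'I_m => c j B k)); last first.
  by move=> k; rewrite -val_eqE/= /c /B' => /negbTE ->.
rewrite -/d muleC => <-; apply: eq_integral => t _.
rewrite mulrC (bigD1 jo)//=; congr (_ * _)%:E.
  by rewrite /F ltnn eqxx.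
apply: eq_bigr => k.
by rewrite -val_eqE/= /F => /negbTE ->.
Qed.

End independent_products.

(** * Exponential moments of one variable *)

Section moment_generating.
Context (R : realType).
Notation T := (measurableTypeR R).
Notation mu := (leb01 R).
Implicit Types (y : T -> R) (p a w th : R).

Definition mgf_const : R := 32 * expR 1.

Lemma mgf_const_ge1 : 1 <= mgf_const.
Proof. by have := @expR_ge1Dx R 1; rewrite /mgf_const; lra. Qed.

Lemma integral_leb01_cst (r : R) : (\int[mu]_t r%:E = r%:E)%E.
Proof.
rewrite integral_cst// -[X in (_ * X)%E]/(leb01 R setT) leb01_setT.
by rewrite mule1.
Qed.

Lemma ge0_le_integral_EFin y1 y2 :
  measurable_fun setT y1 -> measurable_fun setT y2 ->
  (forall t, 0 <= y1 t) -> (forall t, y1 t <= y2 t) ->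
  (\int[mu]_t (y1 t)%:E <= \int[mu]_t (y2 t)%:E)%E.
Proof.
move=> m1 m2 y10 y12; apply: ge0_le_integral => //.
- by move=> t _; rewrite lee_fin.
- exact/measurable_EFinP.
- exact/measurable_EFinP.
- by move=> t _; rewrite lee_fin.
Qed.

Lemma measurable_expR_comp y : measurable_fun setT y ->
  measurable_fun setT (fun t => expR (y t)).
Proof. by move=> my; apply: measurableT_comp. Qed.

Lemma measurable_expR_powR y p : measurable_fun setT y ->
  measurable_fun setT (fun t => expR (`|y t| `^ p)).
Proof.
move=> my; apply: measurable_expR_comp.
exact: (measurableT_comp (measurable_powR p)
  (measurableT_comp (@normr_measurable R setT) my)).
Qed.

Lemma integrable_expR_powR y p : measurable_fun setT y ->
  (\int[mu]_t (expR (`|y t| `^ p))%:E <= 2%:E)%E ->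
  mu.-integrable setT (EFin \o (fun t => expR (`|y t| `^ p))).
Proof.
move=> my y2; apply/integrableP; split.
  by apply/measurable_EFinP; exact: measurable_expR_powR.
under eq_integral do rewrite /= ger0_norm ?expR_ge0//.
by rewrite (le_lt_trans y2)// ltry.
Qed.

(** Used for small th, where the mean of y enters linearly and the rest is
    quadratic in th. *)
Lemma mgf_small p th y : 1 <= p -> `|th| <= 1 / 2 ->
  measurable_fun setT y -> mu.-integrable setT (EFin \o y) ->
  (\int[mu]_t (expR (`|y t| `^ p))%:E <= 2%:E)%E ->
  (\int[mu]_t (expR (th * y t))%:E <=
   (expR (th * (\int[mu]_t y t)%R + th ^+ 2 * mgf_const))%:E)%E.
Proof.
move=> p1 th2 my iy y2.
have iE := integrable_expR_powR my y2.
have iE' : mu.-integrable setT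
    (fun t => (th ^+ 2 * (16 * expR 1 * expR (`|y t| `^ p)))%:E).
  under eq_fun do rewrite mulrA EFinM.
  exact: integrableZl.
have iy' : mu.-integrable setT (fun t => (th * y t)%:E).
  under eq_fun do rewrite EFinM.
  exact: integrableZl.
have i1 : mu.-integrable setT (fun t => (1 + th * y t)%:E).
  under eq_fun do rewrite EFinD.
  apply: integrableD => //.
  exact: finite_measure_integrable_cst.
apply: (@le_trans _ _ (\int[mu]_t (1 + th * y t
    + th ^+ 2 * (16 * expR 1 * expR (`|y t| `^ p)))%:E)%E).
  apply: ge0_le_integral_EFin => [|||t].
  - by apply: measurable_expR_comp; exact: measurable_funM.
  - apply: measurable_funD.
      by apply: measurable_funD => //; exact: measurable_funM.
    apply: measurable_funM => //; apply: measurable_funM => //.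
    exact: measurable_expR_powR.
  - by move=> t; exact: expR_ge0.
  - exact: mgf_pointwise.
under eq_integral do rewrite EFinD.
rewrite integralD//.
under eq_integral do rewrite EFinD.
rewrite integralD//; last exact: finite_measure_integrable_cst.
rewrite integral_leb01_cst.
under [X in (_ + X + _)%E]eq_integral do rewrite EFinM.
rewrite integralZl//.
under [X in (_ + X)%E]eq_integral do rewrite mulrA EFinM.
rewrite integralZl//.
have -> : (\int[mu]_t (y t)%:E = (\int[mu]_t y t)%R%:E)%E.
  by rewrite fineK// integrable_fin_num.
apply: (@le_trans _ _ (1%:E + th%:E * ((\int[mu]_t y t)%R)%:E
   + (th ^+ 2 * (16 * expR 1))%:E * 2%:E)%E).
  by rewrite leeD2l// lee_wpmul2l// lee_fin mulr_ge0 ?sqr_ge0// mulr_ge0// expR_ge0.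
rewrite -!EFinM -!EFinD lee_fin.
apply: le_trans (expR_ge1Dx _); rewrite /mgf_const; lra.
Qed.

(** Used for large th, with no cancellation: Young's inequality splits off the
    deterministic part w `^ p / 4, small enough for the margin needed in mgf_sum. *)
Lemma mgf_large p a w th y : 1 <= p -> 0 <= a -> a * 4 `^ (p - 1) <= 1 ->
  0 <= w -> 0 <= th -> th <= a * w `^ (p - 1) -> measurable_fun setT y ->
  (\int[mu]_t (expR (`|y t| `^ p))%:E <= 2%:E)%E ->
  (\int[mu]_t (expR (th * `|y t|))%:E <=
   (expR (a * w `^ p / 4 + a * 4 `^ (p - 1)))%:E)%E.
Proof.
move=> p1 a0 a1 w0 th0 thw my y2.
set k := a * 4 `^ (p - 1); have k0 : 0 <= k by rewrite mulr_ge0// powR_ge0.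
have iE := integrable_expR_powR my y2.
have iE' : mu.-integrable setT (fun t => (k * expR (`|y t| `^ p))%:E).
  under eq_fun do rewrite EFinM.
  exact: integrableZl.
have mE := measurable_expR_powR p my.
apply: (@le_trans _ _ (\int[mu]_t
    (expR (a * w `^ p / 4) * (1 - k + k * expR (`|y t| `^ p)))%:E)%E).
  apply: ge0_le_integral_EFin => [|||t].
  - apply: measurable_expR_comp; apply: measurable_funM => //.
    exact: measurableT_comp.
  - by apply: measurable_funM => //; apply: measurable_funD => //; exact: measurable_funM.
  - by move=> t; exact: expR_ge0.
  - apply: (@le_trans _ _ (expR (a * w `^ p / 4 + k * `|y t| `^ p))).
      rewrite ler_expR; apply: (le_trans (ler_wpM2r (normr_ge0 _) thw)).
      have := ler_wpM2l a0 (@powR_young _ p 4 _ _ p1 _ (normr_ge0 (y t)) w0).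
      by rewrite /k => /(_ ltac:(by [])); lra.
    rewrite expRD ler_wpM2l ?expR_ge0//.
    by have := @expR_chord _ k (`|y t| `^ p); rewrite k0 a1 => /(_ isT); lra.
under eq_integral do rewrite EFinM.
rewrite integralZl//; last first.
  under eq_fun do rewrite EFinD.
  by apply: integrableD => //; exact: finite_measure_integrable_cst.
under eq_integral do rewrite EFinD.
rewrite integralD//; last exact: finite_measure_integrable_cst.
rewrite integral_leb01_cst.
under eq_integral do rewrite EFinM.
rewrite integralZl//.
apply: (@le_trans _ _ ((expR (a * w `^ p / 4))%:E * ((1 - k)%:E + k%:E * 2%:E))%E).
  by rewrite lee_wpmul2l ?lee_fin ?expR_ge0// leeD2l// lee_wpmul2l.
rewrite -[(k%:E * _)%E]EFinM -[(_ + _)%E]EFinD -EFinM lee_fin expRD ler_wpM2l ?expR_ge0//.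
by apply: le_trans (expR_ge1Dx _); lra.
Qed.

End moment_generating.

(** * Exponential moments of sums *)

Section sum_estimate.
Context (R : realType).
Notation T := (measurableTypeR R).
Notation mu := (leb01 R).
Implicit Types (y : nat -> T -> R).

(** The reciprocal of min(2, p/(p-1)), the largest admissible index. *)
Definition growth_exp (p : R) : R := Num.max 2^-1 (1 - p^-1).

(** Small enough that the quadratic terms of mgf_small, summed over all
    variables, use up at most half of the exponent, up to a constant; see
    tail_rate4. *)
Definition tail_rate (p : R) : R := (2 * mgf_const R * 4 `^ p)^-1.

Lemma integral_expR_sum y (f : R -> R) (b : nat -> R) m :
  (forall n, measurable_fun setT (y n)) -> independent_seq y ->
  measurable_fun setT f ->
  (forall n, (\int[mu]_t (expR (f (y n t)))%:E <= (expR (b n))%:E)%E) ->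
  (\int[mu]_t (expR (\sum_(k < m) f (y k t)))%:E
     <= (expR (\sum_(k < m) b k))%:E)%E.
Proof.
move=> my iy mf fb.
under eq_integral do rewrite expR_sum.
rewrite (@integral_prod_independent R y (fun r => expR (f r)))//; first last.
- by move=> n; rewrite (le_lt_trans (fb n))// ltry.
- exact: measurableT_comp.
rewrite expR_sum -prodEFin.
suff : (0 <= \prod_(k < m) \int[mu]_t (expR (f (y k t)))%:E
          <= \prod_(k < m) (expR (b k))%:E)%E by case/andP.
elim/big_rec2: _ => [|k u w _ /andP[u0 uw]]; first by rewrite lexx lee01.
have E0 : (0 <= \int[mu]_t (expR (f (y k t)))%:E)%E.
  by apply: integral_ge0 => t _; rewrite lee_fin expR_ge0.
by rewrite mule_ge0//= lee_pmul.
Qed.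

Lemma tail_rate_gt0 p : 0 < tail_rate p.
Proof.
rewrite invr_gt0 mulr_gt0 ?powR_gt0// mulr_gt0//.
exact: lt_le_trans (mgf_const_ge1 R).
Qed.

Lemma tail_rate4 p : tail_rate p * 4 `^ p * mgf_const R = 1 / 2.
Proof.
have := mgf_const_ge1 R; have : 0 < 4 `^ p :> R by rewrite powR_gt0.
by move=> p4 c1; rewrite /tail_rate; field; apply/andP; split; lra.
Qed.

(** The three relations that determine the exponent.  The second one uses that
    growth_exp p is at least 1 - 1/p.  The third one uses 1/2 if p <= 2, and the
    second one together with w <= 4 if p >= 2. *)
Lemma growth_exp_scaling (p v m : R) : 1 <= p -> 0 <= v -> 1 <= m ->
  let th := v `^ (p - 1) * m `^ (- growth_exp p) in
  let w := v * m `^ (- p^-1) in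
  [/\ m * w `^ p = v `^ p, th <= w `^ (p - 1) &
      w <= 4 -> m * th ^+ 2 <= 4 `^ p * (1 + v `^ p)].
Proof.
move=> p1 v0 m1 th w.
have p0 : 0 < p by lra.
have m0 : 0 < m by lra.
have w0 : 0 <= w by rewrite mulr_ge0// powR_ge0.
have mw : m * w `^ p = v `^ p.
  rewrite /w powRM ?powR_ge0// -powRrM mulNr mulVf ?gt_eqF// powRN powRr1 ?ltW//.
  by field; rewrite gt_eqF.
have thw : th <= w `^ (p - 1).
  rewrite /th /w powRM ?powR_ge0// ler_wpM2l ?powR_ge0// -powRrM.
  have -> : - p^-1 * (p - 1) = - (1 - p^-1) by field; rewrite gt_eqF.
  by rewrite ler_powR// lerN2 /growth_exp le_max lexx orbT.
split=> // w4.
have p4 : 1 <= 4 `^ p :> R by apply: le_trans (le1r_powR _ p1); lra.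
have [p2|/ltW p2] := leP p 2.
- apply: (@le_trans _ _ (1 * (1 + v `^ p))); last first.
    by rewrite ler_wpM2r// addr_ge0// powR_ge0.
  rewrite mul1r /th exprMn.
  have h1 : m * m `^ (- growth_exp p) ^+ 2 <= 1.
    rewrite -{1}(powRr1 (ltW m0)) -powR_mulrn ?powR_ge0// -powRrM -powRD; last first.
      by apply/implyP => _; rewrite gt_eqF.
    rewrite -[leRHS](powRr0 m) ler_powR//.
    have : 2^-1 <= growth_exp p by rewrite /growth_exp le_max lexx.
    by move=> h; lra.
  have h2 : (v `^ (p - 1)) ^+ 2 <= 1 + v `^ p.
    rewrite -powR_mulrn ?powR_ge0// -powRrM.
    have [v1|/ltW v1] := leP v 1.
      apply: (@le_trans _ _ 1); last by rewrite lerDl powR_ge0.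
      have p22 : 0 <= (p - 1) * 2 by lra.
      by have := ge0_ler_powR p22 (v0 : v \in Num.nneg) ler01 v1; rewrite powR1.
    apply: (@le_trans _ _ (v `^ p)); last by rewrite lerDr.
    by apply: ler_powR => //; lra.
  rewrite mulrCA -[leRHS]mulr1 ler_pM// ?sqr_ge0//.
  by rewrite mulr_ge0 ?sqr_ge0// ltW.
- have th0 : 0 <= th by rewrite mulr_ge0 ?powR_ge0.
  have h1 : th ^+ 2 <= w `^ p * w `^ (p - 2).
    rewrite -powRD; last by apply/implyP => /eqP; lra.
    have -> : p + (p - 2) = (p - 1) * 2%:R by ring.
    rewrite powRrM powR_mulrn ?powR_ge0//.
    by rewrite lerXn2r ?nnegrE ?powR_ge0.
  have h2 : w `^ (p - 2) <= 4 `^ p.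
    apply: (@le_trans _ _ (4 `^ (p - 2))).
      by rewrite ge0_ler_powR ?nnegrE//; lra.
    by apply: ler_powR; lra.
  apply: (le_trans (ler_wpM2l (ltW m0) h1)).
  rewrite mulrA mw mulrC ler_pM ?powR_ge0// lerDr//.
Qed.

Section sums.
Variables (p B : R) (y : nat -> T -> R).
Hypotheses (p1 : 1 <= p) (my : forall n, measurable_fun setT (y n))
  (iy : independent_seq y) (inty : forall n, mu.-integrable setT (EFin \o y n))
  (y2 : forall n, (\int[mu]_t (expR (`|y n t| `^ p))%:E <= 2%:E)%E)
  (yB : forall m, \sum_(k < m) `|(\int[mu]_t y k t)%R| <= B).

Let a : R := tail_rate p.
Let S m t : R := \sum_(k < m.+1) y k t.

Lemma measurable_sum_seq m : measurable_fun setT (S m).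
Proof. by apply: measurable_sum => k. Qed.

(** The factor 1/2 in front of v `^ p is the point: it leaves a margin over the
    value a v^p that the exponent on the left takes when the normalised sum
    equals v. *)
Lemma mgf_sum m (v : R) : 0 <= v ->
  (\int[mu]_t (expR (a * v `^ (p - 1) * (m.+1%:R `^ (- growth_exp p) * `|S m t|)))%:E
    <= (2 * expR (B + 1 + a * v `^ p / 2))%:E)%E.
Proof.
move=> v0; have a0 : 0 < a := tail_rate_gt0 p.
have p0 : 0 < p by exact: lt_le_trans p1.
set M : R := m.+1%:R.
have M1 : 1 <= M by rewrite /M ler1n.
have := growth_exp_scaling p1 v0 M1.
set u : R := v `^ (p - 1) * _; set w : R := v * _ => -[Mw uw w4].
have B0 : 0 <= B by apply: le_trans (yB 0); rewrite big_ord0.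
have c1 := mgf_const_ge1 R; set c := mgf_const R in c1.
have ac : a * 4 `^ p * c = 1 / 2 by exact: tail_rate4.
have p41 : 4 `^ (p - 1) * 4 = 4 `^ p :> R by rewrite mulrC mulr_powRB1.
have p1' : 1 <= p := p1.
have p4_ge4 : 4 <= 4 `^ p :> R by apply: le1r_powR; lra.
have ap0 : 0 < a * 4 `^ p by rewrite mulr_gt0 ?powR_gt0.
have ap2 : a * 4 `^ p <= 1 / 2.
  by rewrite -ac ler_peMr// ltW.
have ap1 : a * 4 `^ (p - 1) <= 1 / 2.
  by apply: le_trans ap2; rewrite ler_pM2l//; have := @powR_ge0 R 4 (p - 1); lra.
have w0 : 0 <= w by rewrite mulr_ge0 ?powR_ge0.
have u0 : 0 <= u by rewrite mulr_ge0 ?powR_ge0.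
pose th : R := a * u.
have th0 : 0 <= th by rewrite mulr_ge0// ltW.
have thw : th <= a * w `^ (p - 1) by rewrite ler_wpM2l// ltW.
have -> : (fun t => (expR (a * v `^ (p - 1) * (M `^ (- growth_exp p) * `|S m t|)))%:E)
        = (fun t => (expR (th * `|S m t|))%:E).
  by apply/funext => t; rewrite /th /u !mulrA.
have mS := measurable_sum_seq m.
have av0 : 0 <= a * v `^ p by rewrite mulr_ge0 ?powR_ge0// ltW.
(* The threshold 4 matches the factor 4 in mgf_large: for w >= 4 the total cost
   of the terms 4 `^ (p - 1) is again at most a v `^ p / 4. *)
have [w_le4|/ltW w_ge4] := leP w 4.
- have th2 : th <= 1 / 2.
    apply: le_trans thw _; apply: le_trans ap1; rewrite ler_pM2l//.
    by rewrite ge0_ler_powR ?nnegrE//; lra.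
  have a1 : a <= 1.
    by have := ler_wpM2l (ltW a0) p4_ge4; lra.
  have cth : M * (th ^+ 2 * c) <= a / 2 * (1 + v `^ p).
    rewrite /th exprMn.
    have ca : 0 <= c * a ^+ 2 by rewrite mulr_ge0 ?sqr_ge0//; lra.
    have := ler_wpM2l ca (w4 w_le4).
    rewrite (_ : c * a ^+ 2 * (4 `^ p * (1 + v `^ p))
      = a * (a * 4 `^ p * c) * (1 + v `^ p)); last by ring.
    by rewrite ac; lra.
  (* `|S| is reduced to S and - S, which costs the factor 2 in the statement. *)
  have one_side (e : R) : `|e| <= 1 -> (\int[mu]_t (expR (e * th * S m t))%:E
      <= (expR (B + 1 + a * v `^ p / 2))%:E)%E.
    move=> e1.
    have eth : `|e * th| <= th.
      by rewrite normrM (ger0_norm th0) -[leRHS]mul1r ler_wpM2r.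
    have h n := @mgf_small _ p (e * th) (y n) p1 (le_trans eth th2) (my n) (inty n) (y2 n).
    under eq_integral do rewrite mulr_sumr.
    apply: le_trans (integral_expR_sum (f := fun r => e * th * r) m.+1 my iy _ h) _.
      by apply: measurable_funM.
    rewrite lee_fin ler_expR big_split/= sumr_const card_ord -mulr_natl -/M.
    rewrite -mulr_sumr.
    have h1 : e * th * (\sum_(k < m.+1) (\int[mu]_t y k t)%R) <= th * B.
      apply: le_trans (ler_norm _) _; rewrite normrM.
      apply: ler_pM => //; apply: le_trans (yB m.+1); exact: ler_norm_sum.
    have h2 : th * B <= B by rewrite ler_piMl//; lra.
    have h3 : M * ((e * th) ^+ 2 * c) <= M * (th ^+ 2 * c).
      rewrite ler_wpM2l// ler_wpM2r//; first lra.
      by rewrite -(real_normK (num_real (e * th))) lerXn2r// nnegrE.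
    rewrite -/c; lra.
  apply: (@le_trans _ _ (\int[mu]_t (expR (1 * th * S m t) + expR (-1 * th * S m t))%:E)%E).
    apply: ge0_le_integral_EFin => [|||t].
    + apply: measurable_expR_comp; apply: measurable_funM => //.
      exact: (measurableT_comp (@normr_measurable R setT) mS).
    + apply: measurable_funD; apply: measurable_expR_comp; exact: measurable_funM.
    + by move=> t; exact: expR_ge0.
    + rewrite mul1r mulN1r mulNr; have [s0|s0] := leP 0 (S m t).
        by rewrite ger0_norm// lerDl expR_ge0.
      by rewrite ltr0_norm// mulrN lerDr expR_ge0.
  under eq_integral do rewrite EFinD.
  have mE (e : R) : measurable_fun setT (fun t => (expR (e * th * S m t))%:E).
    by apply/measurable_EFinP; apply: measurable_expR_comp; exact: measurable_funM.
  rewrite ge0_integralD => [||t _||t _|]; rewrite ?lee_fin ?expR_ge0//.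
  rewrite mulr_natl mulr2n EFinD; apply: leeD; apply: one_side.
    by rewrite normr1.
  by rewrite normrN1.
- have h n := mgf_large p1 (ltW a0) _ w0 th0 thw (my n) (y2 n).
  have {}h n : (\int[mu]_t (expR (th * `|y n t|))%:E
      <= (expR (a * w `^ p / 4 + a * 4 `^ (p - 1)))%:E)%E by apply: h; lra.
  apply: (@le_trans _ _ (\int[mu]_t (expR (\sum_(k < m.+1) (th * `|y k t|)))%:E)%E).
    apply: ge0_le_integral_EFin => [|||t].
    + apply: measurable_expR_comp; apply: measurable_funM => //.
      exact: (measurableT_comp (@normr_measurable R setT) mS).
    + apply: measurable_expR_comp; apply: measurable_sum => k.
      apply: measurable_funM => //.
      exact: (measurableT_comp (@normr_measurable R setT) (my k)).
    + by move=> t; exact: expR_ge0.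
    + by rewrite ler_expR -mulr_sumr ler_wpM2l// ler_norm_sum.
  apply: le_trans (integral_expR_sum (f := fun r => th * `|r|) m.+1 my iy _ h) _.
    by apply: measurable_funM => //; exact: normr_measurable.
  rewrite lee_fin sumr_const card_ord -[_ *+ m.+1]mulr_natl -/M.
  apply: (@le_trans _ _ (expR (B + 1 + a * v `^ p / 2))); last first.
    by rewrite ler_peMl ?expR_ge0//; lra.
  rewrite ler_expR mulrDr.
  have h4 : 4 `^ p <= w `^ p by rewrite ge0_ler_powR ?nnegrE//; lra.
  have h5 : M * (a * 4 `^ (p - 1)) <= a * v `^ p / 4.
    rewrite -Mw (_ : 4 `^ (p - 1) = 4 `^ p / 4); last by rewrite -p41; field.
    have : a * M * 4 `^ p <= a * M * w `^ p.
      by rewrite ler_wpM2l// mulr_ge0//; lra.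
    lra.
  have h6 : M * (a * w `^ p / 4) = a * v `^ p / 4 by rewrite -Mw; ring.
  rewrite h6; lra.
Qed.

End sums.

End sum_estimate.

(** * The norm of a sum of independent variables *)

Section sum_norm.
Context (R : realType).
Notation T := (measurableTypeR R).
Notation mu := (leb01 R).
Implicit Types (x y : T -> R) (p b l : R).

Definition tail_scale p : R := tail_rate p / (4 * 2 `^ p).

Lemma luxemburg_norm_le (N : R -> R) x l : 0 < l ->
  (\int[mu]_t (N (`|x t| / l))%:E <= 1)%E -> (luxemburg_norm N x <= l%:E)%E.
Proof.
by move=> l0 h; apply: ereal_inf_lbound; exists l.
Qed.

(** Integrating the bound of expR_floor_bound term by term leaves a geometric
    series, since a n^p / 2 of the decay 3/4 a n^p is spent on the hypothesis
    and n <= n^p. *)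
Lemma expR_powR_integral_le x p : 1 <= p -> measurable_fun setT x ->
  forall C, (forall v, 0 <= v ->
    (\int[mu]_t (expR (tail_rate p * v `^ (p - 1) * `|x t|))%:E
      <= (C * expR (tail_rate p * v `^ p / 2))%:E)%E) ->
  (\int[mu]_t (expR (tail_scale p * `|x t| `^ p))%:E
    <= (C * expR (tail_scale p) / (1 - expR (- (tail_rate p / 4))))%:E)%E.
Proof.
move=> p1 mx C mgf; set a : R := tail_rate p in mgf *; set b := tail_scale p.
have a0 : 0 < a := tail_rate_gt0 p.
have mnx : measurable_fun setT (fun t => `|x t|).
  exact: (measurableT_comp (@normr_measurable R setT) mx).
pose G (n : nat) t := expR (b - 3 / 4 * a * n%:R `^ p) * expR (a * n%:R `^ (p - 1) * `|x t|).
have G0 n t : 0 <= G n t by rewrite mulr_ge0 ?expR_ge0.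
have mG n : measurable_fun setT (G n).
  by apply: measurable_funM => //; apply: measurable_expR_comp; exact: measurable_funM.
have mEG n : measurable_fun setT (fun t => (G n t)%:E) by exact/measurable_EFinP.
have C0 : 0 <= C.
  have := mgf 0 (lexx 0).
  rewrite (_ : 0 `^ p = 0) ?mulr0 ?mul0r ?expR0 ?mulr1; last by rewrite powR0 ?gt_eqF//; lra.
  move=> h; rewrite -lee_fin; apply: le_trans h.
  by apply: integral_ge0 => t _; rewrite lee_fin expR_ge0.
apply: (@le_trans _ _ (\int[mu]_t (\sum_(n <oo) (G n t)%:E))%E).
  apply: ge0_le_integral => //.
  - apply/measurable_EFinP; apply: measurable_expR_comp; apply: measurable_funM => //.
    exact: (measurableT_comp (measurable_powR p) mnx).
  - by apply: ge0_emeasurable_sum => // n t _ _; rewrite lee_fin.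
  move=> t _; have [n Hn] := @expR_floor_bound R p a `|x t| p1 a0 (normr_ge0 _).
  apply: (@le_trans _ _ (G n t)%:E); first by rewrite lee_fin.
  apply: le_trans (@nneseries_lim_ge R (fun n => (G n t)%:E) xpredT 0 n.+1 _); last first.
    by move=> k _ _; rewrite lee_fin.
  rewrite big_mkord big_ord_recr/= leeDr//.
  by apply: sume_ge0 => k _; rewrite lee_fin.
rewrite integral_nneseries//; last by move=> n t _; rewrite lee_fin.
apply: lime_le.
  by apply: is_cvg_nneseries => n _ _; apply: integral_ge0 => t _; rewrite lee_fin.
apply: nearW => k.
set r := expR (- (a / 4)).
have r0 : 0 < r by exact: expR_gt0.
have r1 : r < 1 by rewrite /r expR_lt1; lra.
apply: (@le_trans _ _ (\sum_(0 <= n < k) (C * expR b * r ^+ n)%:E)%E); last first.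
  rewrite sumEFin lee_fin.
  apply: geometric_le_lim => //; first by rewrite mulr_ge0 ?expR_ge0.
  by rewrite ger0_norm// ltW.
apply: lee_sum => n _.
rewrite /G; under eq_integral do rewrite EFinM.
rewrite ge0_integralZl_EFin//; last first.
  by apply/measurable_EFinP; apply: measurable_expR_comp; exact: measurable_funM.
apply: (le_trans (lee_wpmul2l _ (mgf _ (ler0n R n)))); first by rewrite lee_fin expR_ge0.
rewrite -EFinM lee_fin mulrCA -[leRHS]mulrA ler_wpM2l// -expRD /r -expRM_natr -expRD.
rewrite ler_expR.
have : a * n%:R <= a * n%:R `^ p.
  rewrite ler_pM2l//; case: n => [|n]; first exact: powR_ge0.
  by apply: le1r_powR => //; rewrite ler1n.
set X := n%:R `^ p; lra.
Qed.

(** The constant C is brought below the level 1 of the Luxemburg norm by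
    convexity: exp(s / C) - 1 <= (exp(s) - 1) / C. *)
Lemma luxemburg_norm_le_expR x p b C : 1 <= p -> 0 < b -> 1 <= C ->
  measurable_fun setT x ->
  (\int[mu]_t (expR (b * `|x t| `^ p))%:E <= C%:E)%E ->
  (luxemburg_norm (expN p) x <= ((C / b) `^ p^-1)%:E)%E.
Proof.
move=> p1 b0 C1 mx xC; have p0 : 0 < p by lra.
have l0 : 0 < C / b by rewrite divr_gt0//; lra.
apply: luxemburg_norm_le; first exact: powR_gt0.
have mnx : measurable_fun setT (fun t => `|x t|).
  exact: (measurableT_comp (@normr_measurable R setT) mx).
have mE : measurable_fun setT (fun t => expR (b * `|x t| `^ p)).
  apply: measurable_expR_comp; apply: measurable_funM => //.
  exact: (measurableT_comp (measurable_powR p) mnx).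
apply: (@le_trans _ _ (\int[mu]_t (C^-1 * expR (b * `|x t| `^ p))%:E)%E).
  have e t : (`|x t| / (C / b) `^ p^-1) `^ p = C^-1 * (b * `|x t| `^ p).
    rewrite powRM ?invr_ge0 ?powR_ge0// -powR_inv1 ?powR_ge0// -!powRrM.
    have -> : p^-1 * (-1 * p) = -1 by field; rewrite gt_eqF.
    by rewrite powR_inv1 ?ltW//; field; rewrite !gt_eqF//; lra.
  apply: ge0_le_integral_EFin => [|||t].
  - rewrite /expN; under eq_fun do rewrite e.
    apply: measurable_funB => //; apply: measurable_expR_comp; apply: measurable_funM => //.
    apply: measurable_funM => //.
    exact: (measurableT_comp (measurable_powR p) mnx).
  - exact: measurable_funM.
  - by move=> t; rewrite /expN subr_ge0 -expR0 ler_expR powR_ge0.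
  - rewrite /expN e; have := @expR_chord R C^-1 (b * `|x t| `^ p).
    have c0 : 0 < C^-1 by rewrite invr_gt0; lra.
    rewrite (ltW c0) invf_le1 ?C1; last by lra.
    by move=> /(_ isT); lra.
under eq_integral do rewrite EFinM.
rewrite ge0_integralZl_EFin//; last 2 first.
- exact/measurable_EFinP.
- by rewrite invr_ge0; lra.
apply: le_trans (lee_wpmul2l _ xC) _; first by rewrite lee_fin invr_ge0; lra.
by rewrite -EFinM mulVf// gt_eqF//; lra.
Qed.

Lemma luxemburg_norm_sum_le p (B : R) : 1 <= p -> exists2 L : R, 0 < L &
  forall y : nat -> T -> R, (forall n, measurable_fun setT (y n)) ->
  independent_seq y -> (forall n, mu.-integrable setT (EFin \o y n)) ->
  (forall n, (\int[mu]_t (expR (`|y n t| `^ p))%:E <= 2%:E)%E) ->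
  (forall m, \sum_(k < m) `|(\int[mu]_t y k t)%R| <= B) ->
  forall m, (luxemburg_norm (expN p)
     (fun t => m.+1%:R `^ (- growth_exp p) * \sum_(k < m.+1) y k t)%R <= L%:E)%E.
Proof.
move=> p1; pose b : R := tail_scale p.
pose r : R := expR (- (tail_rate p / 4)).
pose C0 := 2 * expR (B + 1) * expR b / (1 - r).
pose C := 1 + C0.
have a0 := @tail_rate_gt0 R p.
have b0 : 0 < b by rewrite divr_gt0// mulr_gt0// powR_gt0.
have r1 : r < 1 by rewrite /r expR_lt1; lra.
have C00 : 0 <= C0 by rewrite divr_ge0 ?mulr_ge0 ?expR_ge0//; lra.
have C1 : 1 <= C by rewrite /C; lra.
exists ((C / b) `^ p^-1); first by rewrite powR_gt0// divr_gt0//; lra.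
move=> y my iy inty y2 yB m.
have mS : measurable_fun setT
    (fun t => m.+1%:R `^ (- growth_exp p) * \sum_(k < m.+1) y k t).
  by apply: measurable_funM => //; exact: measurable_sum_seq.
apply: luxemburg_norm_le_expR => //.
apply: le_trans (expR_powR_integral_le p1 mS (C := 2 * expR (B + 1)) _) _; last first.
  by rewrite lee_fin /C lerDr.
move=> v v0; rewrite -mulrA -expRD.
have := mgf_sum p1 my iy inty y2 yB m v0.
by under eq_integral do rewrite -[X in X * `|_|](ger0_norm (powR_ge0 _ _)) -normrM.
Qed.

End sum_norm.

(** * A gliding hump *)

Section gliding_hump.
Context {R : realType} {V : Type}.
Variables (P : V -> Prop) (nu : V -> R) (g : nat -> V -> R) (u : nat -> V).
Hypotheses (nu0 : forall z, 0 <= nu z) (Pu : forall k, P (u k))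
  (gP : forall k z, P z -> `|g k z| <= 2 * nu z)
  (gu : forall k, nu (u k) / 2 <= `|g k (u k)|).

Let q (k : nat) : R := 8^-1 ^+ k.

(** Partial sums of the series of the q k g k with signs.  The sign of each step
    is chosen so that the value at u k becomes at least as large as the step. *)
Fixpoint hump (n : nat) (z : V) : R :=
  if n is k.+1 then
    hump k z + (-1) ^+ (`|hump k (u k) + q k * g k (u k)| < q k * `|g k (u k)|)%R
               * (q k * g k z)
  else 0.

Let q0 k : 0 <= q k. Proof. by rewrite exprn_ge0. Qed.

Lemma hump_step k z : P z -> `|hump k.+1 z - hump k z| <= q k * (2 * nu z).
Proof.
move=> Pz; rewrite /= addrAC subrr add0r normrMsign normrM ger0_norm//.
by rewrite ler_wpM2l// gP.
Qed.

(** One of the two sums A + b and A - b has absolute value at least `|b|. *)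
Lemma hump_lower k : q k * (nu (u k) / 2) <= `|hump k.+1 (u k)|.
Proof.
apply: (@le_trans _ _ (q k * `|g k (u k)|)); first by rewrite ler_wpM2l.
rewrite /=; set A := hump k _; set b := q k * g k _.
have -> : q k * `|g k (u k)| = `|b| by rewrite /b normrM ger0_norm.
case: ltP => [h|h]; last by rewrite expr0 mul1r.
rewrite expr1 mulN1r.
have := ler_normB (A + b) (A - b).
have -> : (A + b) - (A - b) = 2 * b by ring.
rewrite normrM ger0_norm//; lra.
Qed.

Lemma hump_tail m d z : P z ->
  `|hump (m + d) z - hump m z| <= 16 / 7 * nu z * (q m - q (m + d)).
Proof.
move=> Pz; elim: d => [|d IH]; first by rewrite addn0 !subrr mulr0 normr0.
rewrite addnS -(subrK (hump (m + d) z) (hump (m + d).+1 z)) -addrA.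
apply: (le_trans (ler_normD _ _)).
apply: (le_trans (lerD (hump_step (m + d) Pz) IH)).
rewrite /q exprS -/(q (m + d)); have := nu0 z; lra.
Qed.

Lemma hump_cvg z : P z -> cvgn (hump ^~ z).
Proof.
move=> Pz; pose v k := hump k.+1 z - hump k z.
have -> : hump ^~ z = series v.
  apply/funext => n; rewrite seriesEnat/= /v telescope_sumr// /=.
  by rewrite subr0.
apply: normed_cvg.
apply: (@series_le_cvg _ _ (geometric (2 * nu z) 8^-1)).
- by move=> n; exact: normr_ge0.
- by move=> n; rewrite geometric_ge0// mulr_ge0.
- move=> n; apply: (le_trans (hump_step n Pz)).
  by rewrite mulrC.
- by apply: is_cvg_geometric_series; rewrite ger0_norm//; lra.
Qed.

(** The values at u k up to step k are at least q k nu (u k) / 2, and the later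
    steps change them by at most 2/7 of q k nu (u k), which leaves 3/14.  If
    nu (u k) grows faster than 8^k, the limit f is unbounded along u.  The
    statement for comb is the linearity of f for an unspecified structure on V. *)
Lemma gliding_hump : exists f : V -> R,
  [/\ (forall z, P z -> `|f z| <= 3 * nu z),
      (forall k, (3 / 14) * q k * nu (u k) <= `|f (u k)|) &
      (forall (comb : R -> V -> V -> V),
        (forall k a y z, P y -> P z -> g k (comb a y z) = a * g k y + g k z) ->
        forall a y z, P y -> P z -> f (comb a y z) = a * f y + f z)].
Proof.
exists (fun z => limn (hump ^~ z)).
have tail m z : P z -> `|limn (hump ^~ z) - hump m z| <= 16 / 7 * nu z * q m.
  move=> Pz.
  have cv : (fun n => `|hump n z - hump m z|) @ \oo --> `|limn (hump ^~ z) - hump m z|.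
    by apply: cvg_norm; apply: cvgB; [exact: hump_cvg|exact: cvg_cst].
  rewrite -(cvg_lim _ cv)//; apply: limr_le; first by apply/cvg_ex; eexists; exact: cv.
  near=> n.
  have /subnKC <- : (m <= n)%N by near: n; exists m.
  apply: (le_trans (hump_tail _ _ Pz)); rewrite ler_wpM2l ?mulr_ge0//.
  by rewrite gerBl.
split=> [z Pz|k|comb gc a y z Py Pz].
- have := tail 0 z Pz; rewrite /= subr0 /q expr0 mulr1.
  by have := nu0 z; lra.
- have := tail k.+1 _ (Pu k); have := hump_lower k.
  rewrite {2}/q exprS -/(q k).
  set L := limn _; set h := hump _ _.
  have := ler_normB L (L - h); rewrite subKr.
  lra.
- apply/cvg_lim => //.
  have -> : hump ^~ (comb a y z) = fun n => a * hump n y + hump n z.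
    apply/funext; elim => [|n IH]; first by rewrite /= mulr0 addr0.
    rewrite /= IH gc//; set e := (_ ^+ _); ring.
  apply: cvgD; last exact: hump_cvg.
  by apply: cvgMr; exact: hump_cvg.
Unshelve. all: by end_near. Qed.

End gliding_hump.

(** * The Orlicz norm and norming functionals *)

Section orlicz_basics.
Context (R : realType).
Notation T := (measurableTypeR R).
Notation mu := (leb01 R).
Implicit Types (x y z Y : T -> R) (p b l C : R) (N : R -> R).

Lemma luxemburg_norm_ge0 N x : (0 <= luxemburg_norm N x)%E.
Proof. by apply: le_ereal_inf_tmp => _ [l [l0 _] <-]; rewrite lee_fin ltW. Qed.

Lemma luxemburg_norm_lt N x (K : R) : (luxemburg_norm N x < K%:E)%E ->
  exists l, [/\ 0 < l, l < K & (\int[mu]_t (N (`|x t| / l))%:E <= 1)%E].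
Proof.
move/ereal_inf_lt => [_ [l [l0 hl] <-]]; rewrite lte_fin => lK.
by exists l.
Qed.

Lemma luxemburg_normZ N x (c : R) : 0 < c ->
  (c%:E * luxemburg_norm N x <= luxemburg_norm N (fun t => c * x t)%R)%E.
Proof.
move=> c0; apply: le_ereal_inf_tmp => _ [l [l0 hl] <-].
have -> : l = c * (l / c) by rewrite mulrC mulfVK// gt_eqF.
rewrite EFinM.
rewrite lee_wpmul2l ?lee_fin ?(ltW c0)//.
apply: luxemburg_norm_le; first exact: divr_gt0.
apply: le_trans hl; rewrite le_eqVlt; apply/orP; left; apply/eqP.
apply: eq_integral => t _; congr (N _)%:E.
by rewrite normrM gtr0_norm// invfM invrK; ring.
Qed.

Lemma le_expN p (u v : R) : 1 <= p -> 0 <= u -> u <= v -> expN p u <= expN p v.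
Proof.
move=> p1 u0 uv; rewrite lerD2r ler_expR ge0_ler_powR ?nnegrE//; first lra.
exact: le_trans uv.
Qed.

Lemma expN_ge0 p (u : R) : 0 <= expN p u.
Proof. by rewrite subr_ge0 -expR0 ler_expR powR_ge0. Qed.

Lemma measurable_expN p x : measurable_fun setT x ->
  measurable_fun setT (fun t => expN p `|x t|).
Proof.
move=> mx; apply: measurable_funB => //.
exact: measurable_expR_powR.
Qed.

Lemma measurable_expN_div p x l : 0 < l -> measurable_fun setT x ->
  measurable_fun setT (fun t => expN p (`|x t| / l)).
Proof.
move=> l0 mx.
have -> : (fun t => expN p (`|x t| / l)) = (fun t => expN p `|x t / l|).
  by apply/funext => t; rewrite normrM (gtr0_norm (_ : 0 < l^-1)) ?invr_gt0.
by apply: measurable_expN; exact: measurable_funM.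
Qed.

Lemma expN_integral_mono p x l (K : R) : 1 <= p -> measurable_fun setT x -> 0 < l -> l <= K ->
  (\int[mu]_t (expN p (`|x t| / K))%:E <= \int[mu]_t (expN p (`|x t| / l))%:E)%E.
Proof.
move=> p1 mx l0 lK; have K0 : 0 < K by exact: lt_le_trans lK.
apply: ge0_le_integral_EFin => [|||t]; rewrite ?expN_ge0//.
- exact: measurable_expN_div.
- exact: measurable_expN_div.
- by move=> t; exact: expN_ge0.
- apply: le_expN => //; first by rewrite divr_ge0// ltW.
  by rewrite ler_wpM2l// lef_pV2.
Qed.

Lemma expR_integral_le2 p x (K : R) : 1 <= p -> measurable_fun setT x ->
  (luxemburg_norm (expN p) x < K%:E)%E ->
  (\int[mu]_t (expR (`|x t / K| `^ p))%:E <= 2%:E)%E.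
Proof.
move=> p1 mx /luxemburg_norm_lt[l [l0 lK hl]].
have K0 : 0 < K by exact: lt_trans lK.
have h := le_trans (expN_integral_mono p1 mx l0 (ltW lK)) hl.
under eq_integral => t _.
  rewrite normrM (gtr0_norm (_ : 0 < K^-1)) ?invr_gt0//.
  rewrite -(subrK 1 (expR _)) EFinD; over.
rewrite ge0_integralD//; last 2 first.
- by move=> t _; rewrite lee_fin; exact: expN_ge0.
- by apply/measurable_EFinP; exact: measurable_expN_div.
by rewrite integral_leb01_cst -[2%:E]/((1 + 1)%:E)%E EFinD leeD2r.
Qed.

(** Boundedness of the pairing with Y is stated through the modular rather than
    the norm, because this is what Young-type inequalities give directly. *)
Definition dual_bound p Y C := measurable_fun setT Y /\
  forall z l, measurable_fun setT z -> 0 < l ->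
    (\int[mu]_t (expN p (`|z t| / l))%:E <= 1)%E ->
    (\int[mu]_t `|z t * Y t|%:E <= (C * l)%:E)%E.

Lemma dual_bound_integrable p Y C z : dual_bound p Y C -> measurable_fun setT z ->
  (luxemburg_norm (expN p) z < +oo)%E ->
  mu.-integrable setT (EFin \o (fun t => z t * Y t)).
Proof.
move=> [mY dY] mz; rewrite ltey_eq.
have : (luxemburg_norm (expN p) z < +oo)%E -> exists K : R, (luxemburg_norm (expN p) z < K%:E)%E.
  have := luxemburg_norm_ge0 (expN p) z.
  case: (luxemburg_norm _ _) => //= r r0 _; exists (r + 1); rewrite lte_fin ltrDl//.
move=> h; rewrite -ltey_eq => /h[K /luxemburg_norm_lt[l [l0 _ hl]]].
apply/integrableP; split; first by apply/measurable_EFinP; exact: measurable_funM.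
by apply: (le_lt_trans (dY z l mz l0 hl)); rewrite ltry.
Qed.

(** Since dual_bound holds for every l admissible in the norm, it passes to the
    infimum. *)
Lemma dual_bound_le p Y C z : 0 <= C -> dual_bound p Y C -> measurable_fun setT z ->
  (luxemburg_norm (expN p) z < +oo)%E ->
  (`|(\int[mu]_t (z t * Y t))%R|%:E <= C%:E * luxemburg_norm (expN p) z)%E.
Proof.
move=> C0 dY mz zoo; have iz := dual_bound_integrable dY mz zoo.
have [mY dY'] := dY.
have h l : 0 < l -> (\int[mu]_t (expN p (`|z t| / l))%:E <= 1)%E ->
    `|(\int[mu]_t (z t * Y t))%R| <= C * l.
  move=> l0 hl; rewrite -lee_fin; apply: le_trans (dY' z l mz l0 hl).
  rewrite EFin_normr_Rintegral//; apply: le_abse_integral => //.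
  by have /integrableP[] := iz.
have := luxemburg_norm_ge0 (expN p) z.
case E : (luxemburg_norm (expN p) z) zoo => [r| |]// _ r0.
rewrite -EFinM lee_fin; apply/ler_addgt0Pr => e e0.
have [l [l0 lr hl]] : exists l, [/\ 0 < l, l < r + e / (C + 1) &
    (\int[mu]_t (expN p (`|z t| / l))%:E <= 1)%E].
  by apply: luxemburg_norm_lt; rewrite E lte_fin ltrDl divr_gt0//; lra.
apply: (le_trans (h l l0 hl)); apply: (le_trans (ler_wpM2l C0 (ltW lr))).
rewrite mulrDr lerD2l mulrCA ler_piMr// ?(ltW e0)// ler_pdivrMr; lra.
Qed.

(** Here u <= expN p u + 1, so that integration is a functional of norm at most 2. *)
Lemma dual_bound1 p : 1 <= p -> dual_bound p (cst 1) 2.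
Proof.
move=> p1; split=> // z l mz l0 hl.
have mN : measurable_fun setT (fun t => (expN p (`|z t| / l))%:E).
  by apply/measurable_EFinP; exact: measurable_expN_div.
apply: (@le_trans _ _ (l%:E * (\int[mu]_t (expN p (`|z t| / l) + 1)%:E))%E).
  rewrite -ge0_integralZl_EFin ?(ltW l0)//; first last.
  - by apply/measurable_EFinP; apply: measurable_funD => //; exact: measurable_expN_div.
  - by move=> t _; rewrite lee_fin addr_ge0// expN_ge0.
  under [in leRHS]eq_integral do rewrite -EFinM.
  apply: ge0_le_integral_EFin => [|||t] //.
  - apply: (measurableT_comp (@normr_measurable R setT)).
    exact: measurable_funM.
  - apply: measurable_funM => //; apply: measurable_funD => //; exact: measurable_expN_div.
  - rewrite mulr1 /expN subrK mulrC -ler_pdivrMr//.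
    have u0 : 0 <= `|z t| / l by rewrite divr_ge0// ltW.
    apply: (le_trans (le_1DpowR p1 u0)); exact: expR_ge1Dx.
under eq_integral do rewrite EFinD.
rewrite ge0_integralD//; last by move=> t _; rewrite lee_fin expN_ge0.
rewrite integral_leb01_cst mulrC EFinM lee_wpmul2l ?lee_fin ?(ltW l0)//.
by rewrite -[2%:E]/((1 + 1)%:E)%E EFinD leeD2r.
Qed.

(** As expN p is convex and vanishes at 0, its slope expN p u / u from the origin
    is nondecreasing; compare u with v. *)
Lemma expN_slope p (u v : R) : 1 <= p -> 0 < u -> 0 <= v ->
  expN p u / u * v <= expN p u + expN p v.
Proof.
move=> p1 u0 v0; have [vu|/ltW uv] := leP v u.
  apply: (@le_trans _ _ (expN p u)); last by rewrite lerDl expN_ge0.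
  by rewrite mulrAC -mulrA ler_piMr ?expN_ge0// ler_pdivrMr// mul1r.
apply: (@le_trans _ _ (expN p v)); last by rewrite lerDr expN_ge0.
have v0' : 0 < v by exact: lt_le_trans uv.
have h0 : 0 <= u / v <= 1 by rewrite divr_ge0 ?(ltW u0)//= ler_pdivrMr// mul1r.
have h1 : (u / v) `^ p <= u / v.
  by apply: ge1r_powR => //; rewrite divr_gt0//=; case/andP: h0.
have h2 : 0 <= (u / v) `^ p <= 1 by rewrite powR_ge0 (le_trans h1)//; case/andP: h0.
have := expR_chord (v `^ p) h2.
rewrite -powRM ?divr_ge0 ?(ltW u0)// mulfVK ?gt_eqF// => h3.
have h4 : expN p u <= u / v * expN p v.
  apply: (@le_trans _ _ ((u / v) `^ p * expN p v)).
    by rewrite /expN; lra.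
  by rewrite ler_wpM2r ?expN_ge0.
apply: (le_trans (ler_wpM2r v0 (ler_wpM2r _ h4))); first by rewrite invr_ge0 ltW.
by rewrite le_eqVlt; apply/orP; left; apply/eqP; field; rewrite !gt_eqF.
Qed.

Lemma measurable_funV x : measurable_fun setT x ->
  measurable_fun setT (fun t => (x t)^-1).
Proof.
move=> mx.
have -> : (fun t => (x t)^-1) = (fun t => x t * `|x t| `^ (- 2%:R)).
  apply/funext => t; have [->|x0] := eqVneq (x t) 0; first by rewrite invr0 mul0r.
  rewrite powR_invn// real_normK ?num_real//; field.
  by rewrite x0.
apply: measurable_funM => //.
apply: (measurableT_comp (measurable_powR _)).
exact: (measurableT_comp (@normr_measurable R setT) mx).
Qed.

(** Up to normalisation Y is N(u) / x with u = `|x| / l and N = expN p, truncated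
    to a set where x is bounded so that the integral of N(u) is finite, but still
    larger than 1.  The bound 2 comes from expN_slope. *)
Lemma norming_functional p x l : 1 <= p -> measurable_fun setT x -> 0 < l ->
  (1 < \int[mu]_t (expN p (`|x t| / l))%:E)%E ->
  exists2 Y, dual_bound p Y 2 & (\int[mu]_t (x t * Y t))%R = l.
Proof.
move=> p1 mx l0 h1.
pose A (n : nat) t := expN p (`|x t| / l) * \1_[set s | `|x s| <= n%:R] t.
have mB (n : nat) : measurable [set s | `|x s| <= n%:R].
  rewrite (_ : [set s | _] = setT `&` (fun s => `|x s|) @^-1` [set` `]-oo, n%:R]]).
    by apply: (measurableT_comp (@normr_measurable R setT) mx).
  by rewrite setTI; apply/seteqP; split => s /=; rewrite in_itv.
have A0 n t : 0 <= A n t by rewrite mulr_ge0// expN_ge0.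
have mA n : measurable_fun setT (A n).
  apply: measurable_funM; first exact: measurable_expN_div.
  exact: measurable_indic.
have Amono t : {homo (fun n => A n t) : m n / (m <= n)%N >-> m <= n}.
  move=> m n mn; rewrite /A ler_wpM2l ?expN_ge0// !indicE ler_nat.
  case: (boolP (t \in _)) => //; rewrite inE/= => h.
  by rewrite mem_set//=; apply: (le_trans h); rewrite ler_nat.
have [n An] : exists n, (1 < \int[mu]_t (A n t)%:E)%E.
  apply: contrapT => /forallNP hn; move: h1; apply/negP; rewrite -leNgt.
  have -> : (\int[mu]_t (expN p (`|x t| / l))%:E = \int[mu]_t (limn (fun n => (A n t)%:E)))%E.
    apply: eq_integral => t _; apply/esym/cvg_lim => //.
    apply: cvg_near_cst; near=> n.
    rewrite /A indicE mem_set ?mulr1//=.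
    apply: (le_trans (ltW (truncnS_gt _))); rewrite ler_nat.
    by near: n; exists (Num.truncn `|x t|).+1.
  rewrite monotone_convergence//.
  - apply: lime_le; last by apply: nearW => n; rewrite leNgt; apply/negP; exact: hn.
    apply: ereal_nondecreasing_is_cvgn => m n mn; apply: ge0_le_integral_EFin => // t.
    exact: Amono.
  - by move=> n; apply/measurable_EFinP.
  - by move=> n t _; rewrite lee_fin.
  - by move=> t _ m n mn; rewrite lee_fin; exact: Amono.
have Afin : (\int[mu]_t (A n t)%:E < +oo)%E.
  apply: (@le_lt_trans _ _ (\int[mu]_t (cst (expN p (n%:R / l)) t)%:E)%E); last first.
    by rewrite integral_leb01_cst ltry.
  apply: ge0_le_integral_EFin => // t; rewrite /A indicE.
  case: (boolP (t \in _)); last by rewrite mulr0 expN_ge0.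
  rewrite inE/= mulr1 => h; apply: le_expN => //; first by rewrite divr_ge0// ltW.
  by rewrite ler_pM2r// invr_gt0.
set r := (\int[mu]_t (A n t))%R.
have Er : (\int[mu]_t (A n t)%:E = r%:E)%E.
  by rewrite fineK// ge0_fin_numE// integral_ge0// => t _; rewrite lee_fin.
have r1 : 1 < r by rewrite -lte_fin -Er.
pose Y t := A n t / x t * (l / r).
have mY : measurable_fun setT Y.
  apply: measurable_funM => //; apply: measurable_funM => //.
  exact: measurable_funV.
have AE t : x t = 0 -> A n t = 0.
  move=> x0; rewrite /A x0 normr0 mul0r /expN powR0 ?expR0 ?subrr ?mul0r//.
  by rewrite gt_eqF//; lra.
exists Y.
- split=> // z k mz k0 hk.
  apply: (@le_trans _ _ ((k / r)%:E * (\int[mu]_t (A n t + expN p (`|z t| / k))%:E))%E).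
    rewrite -ge0_integralZl_EFin ?divr_ge0 ?(ltW k0)//; first last.
    + by lra.
    + by apply/measurable_EFinP; apply: measurable_funD => //; exact: measurable_expN_div.
    + by move=> t _; rewrite lee_fin addr_ge0// expN_ge0.
    under [in leRHS]eq_integral do rewrite -EFinM.
    apply: ge0_le_integral_EFin => [|||t] //.
    + apply: (measurableT_comp (@normr_measurable R setT)); exact: measurable_funM.
    + apply: measurable_funM => //; apply: measurable_funD => //; exact: measurable_expN_div.
    + have k0' := ltW k0; have r0 : 0 < r by lra.
      have rhs0 : 0 <= k / r * (A n t + expN p (`|z t| / k)).
        by rewrite mulr_ge0 ?divr_ge0 ?(ltW r0)// addr_ge0// expN_ge0.
      rewrite /Y; have [x0|x0] := eqVneq (x t) 0.
        by rewrite x0 invr0 !(mul0r, mulr0) normr0.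
      rewrite {1}/A indicE; case: (boolP (t \in _)) => tB; last first.
        by rewrite !(mulr0, mul0r) normr0.
      rewrite {1}/A indicE tB mulr1.
      have u0 : 0 < `|x t| / l by rewrite divr_gt0// normr_gt0.
      have := expN_slope p1 u0 (divr_ge0 (normr_ge0 (z t)) k0').
      have kr0 : 0 <= k / r by rewrite divr_ge0// ltW.
      move/(ler_wpM2l kr0); apply: le_trans.
      rewrite !normrM !normfV (ger0_norm (expN_ge0 _ _)) (gtr0_norm l0) (gtr0_norm r0).
      rewrite le_eqVlt; apply/orP; left; apply/eqP; field.
      by rewrite !gt_eqF// normr_gt0.
  under eq_integral do rewrite EFinD.
  rewrite ge0_integralD//; first last.
  + by apply/measurable_EFinP; exact: measurable_expN_div.
  + by move=> t _; rewrite lee_fin expN_ge0.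
  + exact/measurable_EFinP.
  + by move=> t _; rewrite lee_fin.
  rewrite Er; apply: (@le_trans _ _ ((k / r)%:E * (r%:E + 1))%E).
    by rewrite lee_wpmul2l ?leeD2l// lee_fin divr_ge0 ?(ltW k0)//; lra.
  rewrite -EFinD -EFinM lee_fin mulrAC ler_pdivrMr; last lra.
  have := ltW r1; rewrite -(ler_pM2l k0); lra.
- rewrite /Rintegral.
  have -> : (\int[mu]_t (x t * Y t)%:E =
      \int[mu]_t ((l / r)%:E * (A n t)%:E))%E.
    apply: eq_integral => t _; rewrite -EFinM; congr EFin; rewrite /Y.
    have [/AE ->|x0] := eqVneq (x t) 0; first by rewrite !(mul0r, mulr0).
    by field; rewrite x0 gt_eqF//; lra.
  rewrite ge0_integralZl_EFin//; last by rewrite divr_ge0 ?(ltW l0)//; lra.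
  + by rewrite Er -EFinM/= mulfVK// gt_eqF//; lra.
  + by move=> t _; rewrite lee_fin.
  + exact/measurable_EFinP.
Unshelve. all: by end_near. Qed.

End orlicz_basics.

(** * Weakly null sequences *)

Section weakly_null_sequences.
Context (R : realType).
Notation T := (measurableTypeR R).
Notation mu := (leb01 R).
Implicit Types (x : nat -> T -> R) (y z Y : T -> R) (p q : R).

Lemma expL0_carrier p z : fcarrier (expL0 p) z ->
  [/\ measurable_fun setT z, mu.-integrable setT (EFin \o z) &
      (luxemburg_norm (expN p) z < +oo)%E].
Proof.
move=> [[/Lfun1_integrable iz zoo] _]; split=> //.
by have /integrableP[/measurable_EFinP] := iz.
Qed.

Lemma luxemburg_norm_fineK p z : (luxemburg_norm (expN p) z < +oo)%E ->
  ((fine (luxemburg_norm (expN p) z))%:E = luxemburg_norm (expN p) z)%E.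
Proof. by move=> zoo; rewrite fineK// ge0_fin_numE// luxemburg_norm_ge0. Qed.

Lemma dual_bound_linear p Y C (a : R) y z : dual_bound p Y C ->
  fcarrier (expL0 p) y -> fcarrier (expL0 p) z ->
  (\int[mu]_t ((a \*o y \+ z) t * Y t) =
    a * \int[mu]_t (y t * Y t) + \int[mu]_t (z t * Y t))%R.
Proof.
move=> dY /expL0_carrier[my _ yoo] /expL0_carrier[mz _ zoo].
have iy := dual_bound_integrable dY my yoo.
have iz := dual_bound_integrable dY mz zoo.
have iay : mu.-integrable setT (fun t => (a * (y t * Y t))%:E).
  under eq_fun do rewrite EFinM.
  exact: integrableZl.
rewrite -RintegralZl// -RintegralD//.
by apply: eq_Rintegral => t _ /=; ring.
Qed.

Lemma dual_bound_functional p Y C : 0 <= C -> dual_bound p Y C ->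
  bounded_functional (expL0 p) (fun z => \int[mu]_t (z t * Y t))%R.
Proof.
move=> C0 dY; split=> [a y z yE zE|]; first exact: dual_bound_linear dY yE zE.
exists C => y /expL0_carrier[my _ yoo].
exact: dual_bound_le.
Qed.

(** If the norms were unbounded, some u k would have norm at least 8^k k + 1, and
    the gliding hump over functionals norming the u k gives a bounded functional
    which is unbounded along the sequence. *)
Lemma weakly_null_bounded p x : 1 <= p -> weakly_null (expL0 p) x ->
  exists K : R, forall n, (luxemburg_norm (expN p) (x n) < K%:E)%E.
Proof.
move=> p1 [xE xw]; apply: contrapT => /forallNP noK.
(* The term 1 keeps the norm of u k positive for k = 0. *)
have big (k : nat) : exists n,
    ((8 ^+ k * k%:R + 1)%:E <= luxemburg_norm (expN p) (x n))%E.
  have /existsNP[n hn] := noK (8 ^+ k * k%:R + 1); exists n.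
  by rewrite leNgt; apply/negP.
pose nk k := projT1 (cid (big k)); pose u k := x (nk k).
pose nu z := fine (luxemburg_norm (expN p) z).
have nu0 z : 0 <= nu z by rewrite fine_ge0// luxemburg_norm_ge0.
have Pu k : fcarrier (expL0 p) (u k) by exact: xE.
have nuE z : fcarrier (expL0 p) z -> ((nu z)%:E = luxemburg_norm (expN p) z)%E.
  by move=> /expL0_carrier[_ _ zoo]; exact: luxemburg_norm_fineK.
have nuu k : 8 ^+ k * k%:R + 1 <= nu (u k).
  by rewrite -lee_fin nuE// /u /nk; case: cid.
have nuu0 k : 0 < nu (u k).
  by apply: lt_le_trans (nuu k); rewrite ltr_wpDl// mulr_ge0// exprn_ge0.
have normY k : exists Y, dual_bound p Y 2 /\ (\int[mu]_t (u k t * Y t))%R = nu (u k) / 2.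
  have [mu_k _ _] := expL0_carrier (Pu k).
  have h0 : 0 < nu (u k) / 2 by rewrite divr_gt0.
  have [|Y dY Yl] := norming_functional p1 mu_k h0; last by exists Y.
  rewrite ltNge; apply/negP => /(luxemburg_norm_le h0).
  rewrite -nuE// lee_fin; have := nuu0 k; lra.
pose Y k := projT1 (cid (normY k)).
have dY k : dual_bound p (Y k) 2 by rewrite /Y; case: cid => ? [].
have Yu k : (\int[mu]_t (u k t * Y k t))%R = nu (u k) / 2 by rewrite /Y; case: cid => ? [].
pose g k z := (\int[mu]_t (z t * Y k t))%R.
have gP k z : fcarrier (expL0 p) z -> `|g k z| <= 2 * nu z.
  move=> zE; have [mz _ zoo] := expL0_carrier zE.
  rewrite -lee_fin EFinM nuE//; exact: dual_bound_le.
have gu k : nu (u k) / 2 <= `|g k (u k)| by rewrite /g Yu ler_norm.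
have [f [fle fu flin]] := gliding_hump nu0 Pu gP gu.
have bf : bounded_functional (expL0 p) f.
  split=> [a y z yE zE|].
    have glin k b y' z' : fcarrier (expL0 p) y' -> fcarrier (expL0 p) z' ->
        g k (b \*o y' \+ z') = b * g k y' + g k z'.
      exact: dual_bound_linear (dY k).
    exact: (flin (fun b y' z' => b \*o y' \+ z') glin a y z yE zE).
  by exists 3 => y yE; rewrite -[fnorm _ _](nuE _ yE) -EFinM lee_fin; exact: fle.
have cf : cvgn (fun n => f (x n)) by apply/cvg_ex; exists 0; exact: xw.
have [M [_ MP]] := cvg_seq_bounded cf.
have fM := MP (M + 1) (ltac:(by rewrite ltrDl)).
pose k := (Num.truncn (14 / 3 * (M + 1))).+1.
have := fu k; have := fM (nk k) I; rewrite /= -/(u k) => h1 h2.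
have hk : 14 / 3 * (M + 1) < k%:R by exact: truncnS_gt.
have q0 : 0 < 8^-1 ^+ k :> R by rewrite exprn_gt0.
have := ler_wpM2l (ltW q0) (nuu k).
rewrite mulrDr mulrA -exprMn mulVf// expr1n mul1r mulr1 => h3.
have : 3 / 14 * k%:R <= M + 1.
  apply: le_trans h1; apply: le_trans h2; rewrite -[leRHS]mulrA.
  by rewrite ler_wpM2l//; apply: le_trans h3; rewrite lerDl ltW.
lra.
Qed.

Lemma weakly_null_mean p x : 1 <= p -> weakly_null (expL0 p) x ->
  (\int[mu]_t (x n t))%R @[n --> \oo] --> (0 : R).
Proof.
move=> p1 [_ xw].
have := xw _ (dual_bound_functional _ (dual_bound1 p1)).
by under eq_fun do under eq_Rintegral do rewrite mulr1; apply.
Qed.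

Lemma extract_geometric (e : nat -> R) : e n @[n --> \oo] --> (0 : R) ->
  exists2 s : nat -> nat, increasing_seq s & forall k, `|e (s k)| <= 2^-1 ^+ k.
Proof.
move=> e0.
have ex (k m : nat) : exists n, (m <= n)%N && (`|e n| <= 2^-1 ^+ k).
  have q0 : 0 < 2^-1 ^+ k :> R by rewrite exprn_gt0.
  have /cvgrPdist_le/(_ _ q0)[N _ hN] := e0.
  exists (maxn m N); rewrite leq_maxl/=.
  by have := hN (maxn m N) (leq_maxr _ _); rewrite sub0r normrN.
pose next k m := xchoose (ex k m).
have nextP k m : (m <= next k m)%N /\ `|e (next k m)| <= 2^-1 ^+ k.
  by have /andP := xchooseP (ex k m).
pose s := fix s k := if k is k'.+1 then next k'.+1 (s k').+1 else next 0%N 0%N.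
exists s; last by case=> [|k]; exact: (nextP _ _).2.
by apply/increasing_seqP => k; exact: (nextP k.+1 _).1.
Qed.

End weakly_null_sequences.

(** * Subsequences with the Banach-Saks property *)

Section lower_inclusion.
Context (R : realType).
Notation T := (measurableTypeR R).
Notation mu := (leb01 R).
Implicit Types (x : nat -> T -> R) (p q : R).

Lemma increasing_seq_ge (s : nat -> nat) : increasing_seq s -> forall k, (k <= s k)%N.
Proof.
move=> /increasing_seqP si; elim=> // k IH; exact: leq_ltn_trans IH (si k).
Qed.

Lemma sum_half_le m : \sum_(k < m) (2^-1 : R) ^+ k <= 2.
Proof.
have -> : \sum_(k < m) (2^-1 : R) ^+ k = 2 - 2 * 2^-1 ^+ m.
  elim: m => [|m IH]; first by rewrite big_ord0 expr0 mulr1 subrr.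
  rewrite big_ord_recr/= IH exprS; by field.
by rewrite gerBl mulr_ge0// exprn_ge0.
Qed.

(** The constant M depends on the bounds K and B only, not on the sequence, so
    that it serves all subsequences at once. *)
Lemma BS_sums_bounded p q (K B : R) : 1 <= p -> 0 < K -> growth_exp p <= q^-1 ->
  exists M : R, forall y : nat -> T -> R, (forall n, fcarrier (expL0 p) (y n)) ->
    (forall n, (luxemburg_norm (expN p) (y n) < K%:E)%E) -> independent_seq y ->
    (forall m, \sum_(k < m) `|(\int[mu]_t y k t)%R| <= B) ->
    forall m, ((m.+1%:R `^ (- q^-1))%:E *
      luxemburg_norm (expN p) (fun t => \sum_(k < m.+1) y k t)%R <= M%:E)%E.
Proof.
move=> p1 K0 qk; have [L L0 HL] := @luxemburg_norm_sum_le R p (B / K) p1.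
exists (K * L) => y yE yK iy yB m.
pose z n t := y n t / K.
have my n : measurable_fun setT (y n) by have [] := expL0_carrier (yE n).
have mz n : measurable_fun setT (z n) by exact: measurable_funM.
have iz : independent_seq z.
  apply: (@independent_comp R y id (fun _ r => r / K)) => // _.
  exact: measurable_funM.
have intz n : mu.-integrable setT (EFin \o z n).
  have [_ iyn _] := expL0_carrier (yE n).
  have -> : EFin \o z n = fun t => ((y n t)%:E * (K^-1)%:E)%E by [].
  exact: integrableZr.
have z2 n : (\int[mu]_t (expR (`|z n t| `^ p))%:E <= 2%:E)%E.
  exact: expR_integral_le2.
have zB m' : \sum_(k < m') `|(\int[mu]_t z k t)%R| <= B / K.
  rewrite ler_pdivlMr// mulr_suml; apply: le_trans (yB m'); apply: ler_sum => k _.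
  have [_ iyn _] := expL0_carrier (yE k).
  rewrite RintegralZr// normrM (gtr0_norm (_ : 0 < K^-1)) ?invr_gt0//.
  by rewrite mulfVK// gt_eqF.
have := HL z mz iz intz z2 zB m.
set c := m.+1%:R `^ (- growth_exp p).
have c0 : 0 < c by rewrite powR_gt0// ltr0n.
have -> : (fun t => c * \sum_(k < m.+1) z k t) = (fun t => (c / K) * \sum_(k < m.+1) y k t).
  by apply/funext => t; rewrite /z -mulr_suml mulrA -mulrA (mulrC _ K^-1) mulrA.
have cK0 : 0 < c / K by rewrite divr_gt0.
move/(le_trans (luxemburg_normZ _ _ cK0)) => h.
apply: (@le_trans _ _ (c%:E * luxemburg_norm (expN p) (fun t => \sum_(k < m.+1) y k t)%R)%E).
  rewrite lee_wpmul2r ?luxemburg_norm_ge0// lee_fin /c ler_powR ?ler1n//.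
  by rewrite lerN2.
have -> : c = K * (c / K) by rewrite mulrC mulfVK// gt_eqF.
by rewrite !EFinM -muleA lee_wpmul2l// lee_fin ltW.
Qed.

(** Along s the means are at most 2^-k, and this persists for subsequences. *)
Lemma sub_Gamma_i p q : 1 <= p -> 1 <= q -> growth_exp p <= q^-1 ->
  Gamma_i (expL0 p) q.
Proof.
move=> p1 q1 qk; split=> // x wx ix.
have [K0 xK0] := weakly_null_bounded p1 wx.
pose K := Num.max 1 K0.
have K_gt0 : 0 < K by rewrite lt_max ltr01.
have xK n : (luxemburg_norm (expN p) (x n) < K%:E)%E.
  by apply: lt_le_trans (xK0 n) _; rewrite lee_fin le_max lexx orbT.
have xE := wx.1.
have [s si sle] := extract_geometric (weakly_null_mean p1 wx).
have [M HM] := @BS_sums_bounded p q K 2 p1 K_gt0 qk.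
exists s; first exact: si.
split=> [n| |t ti]; first exact: xE.
- apply: (@le_lt_trans _ _ K%:E); last by rewrite ltry.
  by apply: ge_ereal_sup => _ [n _ <-]; exact/ltW/xK.
- apply: (@le_lt_trans _ _ M%:E); last by rewrite ltry.
  apply: ge_ereal_sup => _ [m _ <-].
  have iy : independent_seq (fun k => x (s (t k))).
    apply: (@independent_comp R x (s \o t) (fun _ => id)) => //.
    by apply: inj_comp; exact: increasing_seq_injective.
  have yB m' : \sum_(k < m') `|(\int[mu]_t' x (s (t k)) t')%R| <= 2.
    apply: le_trans (sum_half_le m'); apply: ler_sum => k _.
    apply: le_trans (sle (t k)) _.
    by rewrite ler_wiXn2l ?increasing_seq_ge//; lra.
  exact: (HM (fun k => x (s (t k))) (fun k => xE _) (fun k => xK _) iy yB m).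
Qed.

End lower_inclusion.

(** * Rademacher functions *)

Section rademacher.
Context (R : realType).
Notation T := (measurableTypeR R).
Notation mu := (leb01 R).

Definition dyadic (N : nat) (t : T) : nat := Num.truncn (2 ^+ N * (t : R)).

Definition rademacher (n : nat) (t : T) : R := (-1) ^+ odd (dyadic n.+1 t).

(** So all digits up to a given place can be read off one integer. *)
Lemma dyadic_half N t : (dyadic N.+1 t)./2 = dyadic N t.
Proof.
rewrite /dyadic exprS -mulrA; set y := 2 ^+ N * _.
have [y0|y0] := leP 0 y; last first.
  have z (w : R) : w < 0 -> Num.truncn w = 0%N.
    by move=> w0; apply/truncn0Pn; rewrite -ltNge; lra.
  by rewrite !z//; lra.
have /andP[h1 h2] := truncn_itv y0.
have y20 : 0 <= 2 * y by lra.
have : (2 * Num.truncn y <= Num.truncn (2 * y))%N.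
  by rewrite truncn_ge_nat// natrM; lra.
have : (Num.truncn (2 * y) < 2 * (Num.truncn y).+1)%N.
  by rewrite truncn_lt_nat// natrM; lra.
lia.
Qed.

Lemma measurable_dyadic_lt N m : measurable [set t : T | (dyadic N t < m)%N].
Proof.
case: m => [|m].
  by rewrite (_ : [set _ | _] = set0)//; apply/seteqP; split => t //=.
rewrite (_ : [set _ | _] = setT `&` (fun t : R => 2 ^+ N * t) @^-1` [set` `]-oo, m.+1%:R[]).
  have mf : measurable_fun setT (fun t : R => 2 ^+ N * t) by apply: measurable_funM.
  exact: mf.
by rewrite setTI; apply/seteqP; split => t /=; rewrite in_itv/= ltnS truncn_le_nat.
Qed.

Lemma measurable_dyadic_eq N k : measurable [set t : T | dyadic N t = k].
Proof.
rewrite (_ : [set _ | _] = [set t | (dyadic N t < k.+1)%N] `\` [set t | (dyadic N t < k)%N]).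
  by apply: measurableD; exact: measurable_dyadic_lt.
apply/seteqP; split => t /=; first by move=> ->; split => //; rewrite ltnn.
by move=> [h1 h2]; apply/eqP; rewrite eqn_leq -ltnS h1/= leqNgt; apply/negP.
Qed.

Lemma measurable_dyadic N (Q : pred nat) : measurable [set t : T | Q (dyadic N t)].
Proof.
rewrite (_ : [set _ | _] = \bigcup_(k in [set k | Q k]) [set t | dyadic N t = k]).
  by apply: bigcup_measurable => k _; exact: measurable_dyadic_eq.
apply/seteqP; split => t /=; first by move=> h; exists (dyadic N t).
by move=> [k /= Qk ->].
Qed.

Lemma leb01_dyadic_eq N k : (k < 2 ^ N)%N ->
  mu [set t : T | dyadic N t = k] = ((2 ^+ N)^-1)%:E.
Proof.
move=> kN; rewrite /leb01 /mrestr.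
have p0 : 0 < 2 ^+ N :> R by rewrite exprn_gt0.
rewrite (_ : _ `&` _ = [set` `[k%:R / 2 ^+ N, k.+1%:R / 2 ^+ N[]).
  rewrite lebesgue_measure_itv/= lte_fin ltr_pM2r ?invr_gt0// ltr_nat ltnSn.
  by rewrite -EFinB -mulrBl -natrB// subSnn mul1r.
apply/seteqP; split => t /=; rewrite !in_itv/=.
- move=> [Dk /andP[t0 t1]]; have y0 : 0 <= 2 ^+ N * t by rewrite mulr_ge0// ltW.
  have := truncn_itv y0; rewrite -[Num.truncn _]/(dyadic N t) Dk.
  by rewrite ler_pdivrMr// ltr_pdivlMr// mulrC.
- rewrite ler_pdivrMr// ltr_pdivlMr// mulrC => h; split; first exact: truncn_def.
  case/andP: h => h1 h2; rewrite -(ler_pM2l p0) -(ler_pM2l p0 t) mulr0 mulr1.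
  rewrite (le_trans _ h1)//= (le_trans (ltW h2))// -natrX ler_nat//.
Qed.

(** Lebesgue measure of sets that depend on finitely many binary digits is a
    count of integers.  The point 1, where dyadic N equals 2 ^ N, is null. *)
Lemma leb01_dyadic N (Q : pred nat) :
  mu [set t : T | Q (dyadic N t)] = ((\sum_(k < 2 ^ N) Q k)%:R / 2 ^+ N)%:E.
Proof.
have p0 : 0 < 2 ^+ N :> R by rewrite exprn_gt0.
have cumul M : (M <= 2 ^ N)%N ->
    mu [set t : T | Q (dyadic N t) && (dyadic N t < M)%N]
      = ((\sum_(k < M) Q k)%:R / 2 ^+ N)%:E.
  elim: M => [_|M IH MN].
    rewrite big_ord0 mul0r (_ : [set _ | _] = set0) ?measure0//.
    by apply/seteqP; split => t //=; rewrite andbF.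
  have -> : [set t : T | Q (dyadic N t) && (dyadic N t < M.+1)%N] =
      [set t : T | Q (dyadic N t) && (dyadic N t < M)%N] `|`
      [set t : T | Q (dyadic N t) && (dyadic N t == M)].
    apply/seteqP; split => t /=.
      rewrite ltnS leq_eqVlt => /andP[-> /orP[->|->]]; by [right|left].
    by move=> [|] /andP[-> /=]; [exact: ltnW|move/eqP => ->].
  transitivity (mu [set t : T | Q (dyadic N t) && (dyadic N t < M)%N] +
      mu [set t : T | Q (dyadic N t) && (dyadic N t == M)])%E.
    apply: measureU.
    - exact: (measurable_dyadic N (fun k => Q k && (k < M)%N)).
    - exact: (measurable_dyadic N (fun k => Q k && (k == M))).
    apply/seteqP; split => t //= [/andP[_ h1] /andP[_ /eqP h2]].
      by rewrite h2 ltnn in h1.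
  rewrite IH ?(ltnW MN)// big_ord_recr/= natrD mulrDl EFinD; congr (_ + _)%E.
  case QM : (Q M).
    rewrite (_ : [set _ | _] = [set t | dyadic N t = M]).
      by rewrite leb01_dyadic_eq// mul1r.
    apply/seteqP; split => t /=; first by move/andP => [_ /eqP].
    by move=> ->; rewrite QM eqxx.
  rewrite mul0r (_ : [set _ | _] = set0) ?measure0//.
  by apply/seteqP; split => t //= /andP[+ /eqP h]; rewrite h QM.
have tail : mu [set t : T | Q (dyadic N t) && (2 ^ N <= dyadic N t)%N] = 0.
  apply/eqP; rewrite -measure_le0.
  have <- : @lebesgue_measure R [set 1] = 0 by rewrite lebesgue_measure_set1.
  rewrite /leb01 /mrestr; apply: le_measure; rewrite ?inE//.
    by apply: measurableI => //; exact: (measurable_dyadic N (fun k => Q k && (2 ^ N <= k)%N)).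
  move=> t /= [/andP[_ h]]; rewrite in_itv/= => /andP[t0 t1].
  apply/eqP; rewrite eq_le t1/=.
  move: h; rewrite /dyadic truncn_ge_nat; last by rewrite mulr_ge0// ltW.
  by rewrite natrX -{1}(mulr1 (2 ^+ N)) ler_pM2l.
have -> : [set t : T | Q (dyadic N t)] =
    [set t : T | Q (dyadic N t) && (dyadic N t < 2 ^ N)%N] `|`
    [set t : T | Q (dyadic N t) && (2 ^ N <= dyadic N t)%N].
  apply/seteqP; split => t /=.
    by move=> ->; case: ltnP => _; [left|right].
  by move=> [|] /andP[].
transitivity (mu [set t : T | Q (dyadic N t) && (dyadic N t < 2 ^ N)%N] +
    mu [set t : T | Q (dyadic N t) && (2 ^ N <= dyadic N t)%N])%E.
  apply: measureU.
  - exact: (measurable_dyadic N (fun k => Q k && (k < 2 ^ N)%N)).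
  - exact: (measurable_dyadic N (fun k => Q k && (2 ^ N <= k)%N)).
  apply/seteqP; split => t //= [/andP[_ h1] /andP[_ h2]].
  by rewrite ltnNge h2 in h1.
by rewrite cumul// tail adde0.
Qed.

Lemma sum_half_odd M (Q c : nat -> nat) :
  (\sum_(k < M.*2) Q k./2 * c (odd k) = (\sum_(k < M) Q k) * (c 0 + c 1))%N.
Proof.
elim: M => [|M IH]; first by rewrite !big_ord0.
rewrite doubleS !big_ord_recr/= IH /= odd_double uphalf_double half_double/=.
by rewrite mulnDl -addnA -mulnDr.
Qed.

(** The integer dyadic N.+1 t is twice dyadic N t plus the digit that determines
    rademacher N t, and both digits occur over each integer. *)
Lemma leb01_rademacher_inter N (Q : pred nat) (B : set R) :
  mu [set t : T | Q (dyadic N t) && (rademacher N t \in B)] =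
  (mu [set t : T | Q (dyadic N t)] *
     (((1 \in B) + (-1 \in B))%:R / 2)%:E)%E.
Proof.
pose c (b : nat) : nat := ((-1) ^+ b \in B).
have -> : [set t : T | Q (dyadic N t) && (rademacher N t \in B)] =
    [set t : T | (fun k => Q k./2 && ((-1) ^+ odd k \in B)) (dyadic N.+1 t)].
  by apply/seteqP; split => t /=; rewrite dyadic_half.
rewrite (leb01_dyadic N.+1 (fun k => Q k./2 && ((-1) ^+ odd k \in B))).
rewrite leb01_dyadic -EFinM; congr (_%:E).
have -> : (\sum_(k < 2 ^ N.+1) (Q k./2 && ((-1) ^+ odd k \in B)) =
    (\sum_(k < 2 ^ N) Q k) * (c 0 + c 1))%N.
  rewrite -(sum_half_odd _ Q c) expnS mul2n.
  by apply: eq_bigr => k _; rewrite mulnb.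
by rewrite /c expr0 expr1 natrM exprS; field; rewrite gt_eqF ?exprn_gt0.
Qed.

Lemma leb01_rademacher N (B : set R) :
  mu (rademacher N @^-1` B) = (((1 \in B) + (-1 \in B))%:R / 2)%:E.
Proof.
have -> : rademacher N @^-1` B = [set t : T | xpredT (dyadic N t) && (rademacher N t \in B)].
  by apply/seteqP; split => t /=; rewrite inE.
rewrite (leb01_rademacher_inter N xpredT B).
have -> : mu [set t : T | xpredT (dyadic N t)] = 1%E.
  by rewrite -(leb01_setT R); congr (mu _); apply/seteqP.
by rewrite mul1e.
Qed.

Lemma rademacher_iid : identically_distributed rademacher.
Proof. by move=> m n B _; rewrite !leb01_rademacher. Qed.

Lemma measurable_rademacher n : measurable_fun setT (rademacher n).
Proof.
move=> _ B mB; rewrite setTI.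
have -> : rademacher n @^-1` B = [set t : T | (-1) ^+ odd (dyadic n.+1 t) \in B].
  by apply/seteqP; split => t /=; rewrite inE.
exact: (measurable_dyadic n.+1 (fun k => (-1) ^+ odd k \in B)).
Qed.

(** An intersection of events of the first N functions is a condition on
    dyadic N t, and leb01_rademacher_inter peels off the last factor. *)
Lemma rademacher_independent : independent_seq rademacher.
Proof.
move=> J B uJ mB.
(* The indices outside J get the sure event, so that J becomes an initial segment. *)
pose B' n := if n \in J then B n else setT.
pose Q := fix Q N k := if N is N'.+1 then
  Q N' k./2 && ((-1) ^+ odd k \in B' N') else true.
have QE N : [set t : T | Q N (dyadic N t)] =
    \bigcap_(n in [set n | (n < N)%N]) rademacher n @^-1` B' n.
  elim: N => [|N IH].
    by apply/seteqP; split => t.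
  apply/seteqP; split => t /=; rewrite dyadic_half.
    move=> /andP[QN]; rewrite inE => hB n /=.
    rewrite ltnS leq_eqVlt => /orP[/eqP -> //|nN].
    have : [set t : T | Q N (dyadic N t)] t by [].
    by rewrite IH => /(_ n nN).
  move=> h; apply/andP; split; last by rewrite inE; exact: (h N (ltnSn N)).
  have : [set t : T | Q N (dyadic N t)] t by rewrite IH => n nN; apply: h; exact: ltnW.
  by [].
have prod N : mu [set t : T | Q N (dyadic N t)] =
    (\prod_(0 <= n < N) mu (rademacher n @^-1` B' n))%E.
  elim: N => [|N IH].
    rewrite big_nil -(leb01_setT R); congr (mu _).
    by apply/seteqP; split.
  rewrite big_nat_recr//= -IH leb01_rademacher -leb01_rademacher_inter.
  by congr (mu _); apply/seteqP; split => t /=; rewrite dyadic_half.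
pose N := (\max_(n <- J) n).+1.
have JN n : n \in J -> (n < N)%N by move=> nJ; rewrite ltnS; exact: leq_bigmax_seq.
transitivity (\prod_(0 <= n < N) mu (rademacher n @^-1` B' n))%E.
  rewrite -prod QE; congr (mu _); apply/seteqP; split => t /= h n.
    by move=> _; rewrite /= /B'; case: ifP => // nJ; exact: h.
  by move=> nJ; have := h n (JN n nJ); rewrite /B' (nJ : n \in J).
rewrite (bigID (fun n => n \in J))/= [X in (_ * X)%E]big1 ?mule1; last first.
  move=> n nJ; rewrite /B' (negbTE nJ) preimage_setT; exact: leb01_setT.
rewrite -big_filter; apply: etrans (perm_big J _) _.
  apply: uniq_perm => //; first by rewrite filter_uniq// iota_uniq.
  move=> n; rewrite mem_filter mem_index_iota; case nJ : (n \in J) => //=.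
  by rewrite JN.
by rewrite big_seq [RHS]big_seq; apply: eq_bigr => n nJ; rewrite /B' nJ.
Qed.

End rademacher.

(** * Sums of Rademacher functions *)

Section rademacher_sums.
Context (R : realType).
Notation T := (measurableTypeR R).
Notation mu := (leb01 R).
Implicit Types (p q : R).
Local Notation r := (@rademacher R).

Lemma powR_unbounded (d A : R) : 0 < d -> exists m : nat, A < m.+1%:R `^ d.
Proof.
move=> d0; pose b : R := `|A| + 1; have b0 : 0 < b by rewrite ltr_wpDl.
exists (Num.truncn (b `^ d^-1)); apply: (@lt_le_trans _ _ b).
  by rewrite /b (le_lt_trans (ler_norm A))// ltrDl.
have bE : (b `^ d^-1) `^ d = b by rewrite -powRrM mulVf ?gt_eqF// powRr1// ltW.
rewrite -{1}bE; apply: ge0_ler_powR; rewrite ?nnegrE ?powR_ge0 ?(ltW d0)//.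
by apply: ltW; exact: truncnS_gt.
Qed.

Lemma bounded_expL0 p (z : T -> R) (M : R) : 1 <= p -> measurable_fun setT z ->
  (forall t, `|z t| <= M) -> fcarrier (expL0 p) z.
Proof.
move=> p1 mz zM; have M0 : 0 <= M := le_trans (normr_ge0 _) (zM 0).
split; first split.
- apply/Lfun1_integrable/integrableP; split; first exact/measurable_EFinP.
  apply: (@le_lt_trans _ _ (\int[mu]_t M%:E)%E); last by rewrite integral_leb01_cst ltry.
  apply: ge0_le_integral_EFin => // t.
  exact: (measurableT_comp (@normr_measurable R setT) mz).
- pose C := Num.max 1 (expR (M `^ p)).
  apply: (@le_lt_trans _ _ ((C / 1) `^ p^-1)%:E); last by rewrite ltry.
  apply: luxemburg_norm_le_expR => //; first by rewrite le_max lexx.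
  rewrite -(integral_leb01_cst C); apply: ge0_le_integral_EFin => // [|t].
  + apply: measurable_expR_comp; apply: measurable_funM => //.
    apply: (measurableT_comp (measurable_powR p)).
    exact: (measurableT_comp (@normr_measurable R setT) mz).
  + rewrite mul1r le_max ler_expR ge0_ler_powR ?nnegrE ?orbT//; lra.
- move=> e e0; exists z.
    rewrite inE; apply/andP; split; first by rewrite inE.
    rewrite inE/= /finite_norm unlock.
    case: ifP => // _.
    apply: (@le_lt_trans _ _ M%:E); last by rewrite ltry.
    apply/ess_supP; apply: aeW => t /=; by rewrite lee_fin.
  apply: (@le_lt_trans _ _ (e / 2)%:E); last by rewrite lte_fin; lra.
  apply: luxemburg_norm_le; first by lra.
  under eq_integral do rewrite /= subrr normr0 mul0r /expN powR0 ?expR0 ?subrr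
    ?gt_eqF ?(lt_le_trans ltr01 p1)//.
  by rewrite integral_leb01_cst lee01.
Qed.

Lemma normr_rademacher n t : `|r n t| = 1.
Proof. by rewrite /rademacher normrX normrN1 expr1n. Qed.

Lemma integral_rademacher (g : R -> R) n :
  (\int[mu]_t (g (r n t))%:E = ((g 1 + g (-1)) / 2)%:E)%E.
Proof.
pose A := r n @^-1` [set 1].
have mA : measurable A by rewrite /A -[X in measurable X]setTI; exact: measurable_rademacher.
have muA : mu A = (1 / 2)%:E.
  rewrite leb01_rademacher mem_set// memNset ?addn0//= => /eqP.
  by rewrite lt_eqF//; lra.
have gE t : (g (r n t))%:E = ((g (-1))%:E + (g 1 - g (-1))%:E * (\1_A t)%:E)%E.
  rewrite -EFinM -EFinD indicE /A; congr EFin.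
  have : r n t = 1 \/ r n t = -1.
    by rewrite /rademacher; case: odd; [right; rewrite expr1|left].
  case=> rt.
    by rewrite mem_set//= rt mulr1 addrC subrK.
  rewrite memNset//= ?rt ?mulr0 ?addr0// => /eqP.
  by rewrite lt_eqF//; lra.
under eq_integral do rewrite gE.
have iA : mu.-integrable setT (fun t => (\1_A t)%:E).
  by apply: integrable_indic => //; rewrite -ge0_fin_numE// fin_num_measure.
rewrite integralD//; last 2 first.
- exact: finite_measure_integrable_cst.
- exact: integrableZl.
rewrite integral_leb01_cst integralZl// integral_indic// setIT.
rewrite -[X in (_ * X)%E]/(mu A) muA -EFinM -EFinD; congr EFin; by field.
Qed.

Lemma rademacher_expL0 p n : 1 <= p -> fcarrier (expL0 p) (r n).
Proof.
move=> p1; apply: (@bounded_expL0 _ _ 1) => //; first exact: measurable_rademacher.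
by move=> t; rewrite normr_rademacher.
Qed.

Lemma signed_rademacher_norm p : 1 <= p ->
  exists K : R, 0 < K /\ forall n (e : R), `|e| <= 1 ->
    (luxemburg_norm (expN p) (fun t => e * r n t)%R < K%:E)%E.
Proof.
move=> p1; exists ((expR 1 / 1) `^ p^-1 + 1).
have K0 : 0 < (expR 1 / 1) `^ p^-1 :> R by rewrite powR_gt0// divr_gt0// expR_gt0.
split; first by rewrite ltr_pwDl// .
move=> n e e1; apply: (@le_lt_trans _ _ ((expR 1 / 1) `^ p^-1)%:E); last first.
  by rewrite lte_fin ltrDl.
have me : measurable_fun setT (fun t => e * r n t).
  by apply: measurable_funM => //; exact: measurable_rademacher.
apply: luxemburg_norm_le_expR => //; first by rewrite -expR0 ler_expR.
rewrite -(integral_leb01_cst (expR 1)); apply: ge0_le_integral_EFin => // [|t].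
+ apply: measurable_expR_comp; apply: measurable_funM => //.
  apply: (measurableT_comp (measurable_powR p)).
  exact: (measurableT_comp (@normr_measurable R setT) me).
+ rewrite mul1r ler_expR normrM normr_rademacher mulr1.
  have p0 : 0 <= p by lra.
  by have := ge0_ler_powR p0 (normr_ge0 e : `|e| \in Num.nneg) ler01 e1; rewrite powR1.
Qed.

Lemma infinitely_often_subseq (P : nat -> Prop) :
  (forall N, exists2 n, (N <= n)%N & P n) ->
  exists2 s : nat -> nat, increasing_seq s & forall k, P (s k).
Proof.
move=> PN.
have [next nextP] : {next : nat -> nat | forall N, (N <= next N)%N /\ P (next N)}.
  exists (fun N => projT1 (cid2 (PN N))) => N.
  by case: cid2.
pose s := fix s k := if k is k'.+1 then next (s k').+1 else next 0%N.
exists s; last by case=> [|k]; exact: (nextP _).2.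
by apply/increasing_seqP => k; exact: (nextP _).1.
Qed.

Lemma growth_exp_lt1 p : 1 <= p -> growth_exp p < 1.
Proof.
move=> p1; have p0 : 0 < p^-1 by rewrite invr_gt0; lra.
by rewrite /growth_exp gt_max; apply/andP; split; lra.
Qed.

Lemma bounded_functional_sum p f (e : nat -> R) (s : nat -> nat) m : 1 <= p ->
  bounded_functional (expL0 p) f ->
  f (fun t => \sum_(k < m) e k * r (s k) t) = \sum_(k < m) e k * f (r (s k)).
Proof.
move=> p1 [flin _].
have E0 : fcarrier (expL0 p) (fun=> 0 : R).
  by apply: (@bounded_expL0 _ _ 0) => // t; rewrite normr0.
elim: m => [|m IH].
  rewrite big_ord0; under eq_fun do rewrite big_ord0.
  have := flin 1 _ _ E0 E0.
  have -> : 1 \*o (fun=> 0) \+ (fun=> 0) = (fun=> 0) :> (T -> R).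
    by apply/funext => t /=; rewrite mulr0 addr0.
  by rewrite mul1r => /eqP; rewrite -subr_eq0 opprD addrA subrr sub0r oppr_eq0 => /eqP.
rewrite big_ord_recr/= -IH addrC -flin; first last.
- apply: (@bounded_expL0 _ _ (\sum_(k < m) `|e k|)) => //.
    apply: measurable_sum => k; apply: measurable_funM => //.
    exact: measurable_rademacher.
  move=> t; apply: le_trans (ler_norm_sum _ _ _) _.
  by apply: ler_sum => k _; rewrite normrM normr_rademacher mulr1.
- exact: rademacher_expL0.
by congr f; apply/funext => t /=; rewrite big_ord_recr/= addrC.
Qed.

(** Choosing the signs so that all values of f add up contradicts the growth of
    the norms, because growth_exp p < 1. *)
Lemma rademacher_weakly_null p : 1 <= p -> weakly_null (expL0 p) r.
Proof.
move=> p1; split=> [n|f bf]; first exact: rademacher_expL0.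
have [_ [C fC]] := bf.
apply: contrapT => not0.
have [e e0 often] : exists2 e : R, 0 < e & forall N, exists2 n, (N <= n)%N & e <= `|f (r n)|.
  apply: contrapT => noe; apply: not0; apply/cvgrPdist_lt => e e0.
  have : ~ (forall N, exists2 n, (N <= n)%N & e <= `|f (r n)|) by move=> h; apply: noe; exists e.
  move=> /existsNP[N hN]; exists N => // n /= Nn; rewrite sub0r normrN.
  by rewrite ltNge; apply/negP => h; apply: hN; exists n.
have [s si sP] := infinitely_often_subseq often.
pose sg k : R := (-1) ^+ (f (r (s k)) < 0)%R.
have sg1 k : `|sg k| = 1 by rewrite normrX normrN1 expr1n.
have sgf k : sg k * f (r (s k)) = `|f (r (s k))|.
  by rewrite /sg; case: ltP => h; rewrite ?expr1 ?expr0 ?mulN1r ?mul1r ?(ltr0_norm h) ?(ger0_norm h).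
pose y k t := sg k * r (s k) t.
have [K [K0 HK]] := @signed_rademacher_norm p p1.
have qk : growth_exp p <= (growth_exp p)^-1^-1 by rewrite invrK.
have [M HM] := @BS_sums_bounded R p (growth_exp p)^-1 K 0 p1 K0 qk.
have my n : measurable_fun setT (y n).
  by apply: measurable_funM => //; exact: measurable_rademacher.
have yE n : fcarrier (expL0 p) (y n).
  apply: (@bounded_expL0 _ _ 1) => // t.
  by rewrite normrM sg1 normr_rademacher mulr1.
have yK n : (luxemburg_norm (expN p) (y n) < K%:E)%E by apply: HK; rewrite sg1.
have iy : independent_seq y.
  apply: (@independent_comp R r s (fun k u => sg k * u)).
  - exact: increasing_seq_injective.
  - by move=> n; apply: measurable_funM.
  - exact: rademacher_independent.
have yB m : \sum_(k < m) `|(\int[mu]_t y k t)%R| <= 0.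
  rewrite big1// => k _; rewrite /Rintegral (integral_rademacher (fun u => sg k * u)).
  by rewrite mulr1 mulrN1 subrr mul0r normr0.
have bound m : m.+1%:R * e <= `|C| * M * m.+1%:R `^ growth_exp p.
  have h := HM y yE yK iy yB m.
  set S := fun t => _ in h.
  have SE : fcarrier (expL0 p) S.
    apply: (@bounded_expL0 _ _ m.+1%:R) => //; first exact: measurable_sum_seq.
    move=> t; apply: le_trans (ler_norm_sum _ _ _) _.
    rewrite (eq_bigr (fun=> 1)) ?sumr_const ?card_ord// => k _.
    by rewrite normrM sg1 normr_rademacher mulr1.
  have [_ _ Soo] := expL0_carrier SE.
  have := fC S SE; rewrite -[fnorm _ _](luxemburg_norm_fineK Soo) -EFinM lee_fin.
  move: h; rewrite -(luxemburg_norm_fineK Soo) -EFinM lee_fin invrK.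
  set nS := fine _; have nS0 : 0 <= nS by rewrite fine_ge0// luxemburg_norm_ge0.
  set c := m.+1%:R `^ growth_exp p.
  have c0 : 0 < c by rewrite powR_gt0// ltr0n.
  rewrite powRN -/c => h1 h2.
  have h3 : nS <= M * c by rewrite mulrC ler_pdivrMr// in h1.
  have -> : `|C| * M * c = `|C| * (M * c) by rewrite mulrA.
  apply: le_trans (ler_wpM2l (normr_ge0 C) h3).
  apply: le_trans (ler_wpM2r nS0 (ler_norm C)); apply: le_trans h2.
  rewrite /S (bounded_functional_sum sg s m.+1 p1 bf) ger0_norm; last first.
    by apply: sumr_ge0 => k _; rewrite sgf.
  under eq_bigr do rewrite sgf.
  rewrite mulr_natl -[X in e *+ X]card_ord -sumr_const.
  by apply: ler_sum => k _; exact: sP.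
have d0 : 0 < 1 - growth_exp p by have := growth_exp_lt1 p1; lra.
have [m hm] := powR_unbounded (`|C| * M / e) d0.
have := bound m; apply/negP; rewrite -ltNge.
have n0 : 0 < m.+1%:R `^ growth_exp p :> R by rewrite powR_gt0// ltr0n.
move: hm; rewrite ltr_pdivrMr// -(ltr_pM2r n0) [X in _ < X -> _]mulrAC -powRD; last first.
  by rewrite subrK oner_eq0.
by rewrite subrK powRr1.
Qed.

(** Here cosh x = 1 + (exp(x/2) - exp(-x/2))^2 / 2, and the difference of the
    exponentials is at least x/2. *)
Lemma cosh_ge (x : R) : 0 <= x -> 1 + x ^+ 2 / 8 <= (expR x + expR (- x)) / 2.
Proof.
move=> x0; pose u := expR (x / 2); pose w := expR (- (x / 2)).
have uw : u * w = 1 by rewrite /u /w -expRD subrr expR0.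
have -> : expR x = u ^+ 2 by rewrite -expRM_natl; congr expR; field.
have -> : expR (- x) = w ^+ 2 by rewrite -expRM_natl; congr expR; field.
have u1 : 1 + x / 2 <= u by exact: expR_ge1Dx.
have w1 : w <= 1 by rewrite expR_le1; lra.
have h : (x / 2) ^+ 2 <= (u - w) ^+ 2 by rewrite lerXn2r ?nnegrE//; lra.
rewrite !expr2 in h *; lra.
Qed.

(** By Young's inequality exp(v^(p-1) S / l) is at most exp(v^p) exp((`|S| / l)^p),
    so cosh(v^(p-1) / l)^m <= 2 exp(v^p).  Taking v = 1 gives l of order at least
    m^(1/2), and taking v = m^(1/p) gives order at least m^(1 - 1/p). *)
Lemma rademacher_sum_lower p (s : nat -> nat) m (l : R) : 1 <= p -> injective s -> 0 < l ->
  (\int[mu]_t (expN p (`|(\sum_(k < m.+1) r (s k) t)%R| / l))%:E <= 1)%E ->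
  m.+1%:R `^ growth_exp p <= 16 * expR 1 * l.
Proof.
move=> p1 s_inj l0 hl.
set S := fun t => \sum_(k < m.+1) r (s k) t.
have e2 : 2 <= expR 1 :> R by have := @expR_ge1Dx R 1; lra.
have my k : measurable_fun setT (r (s k)) by exact: measurable_rademacher.
have iy : independent_seq (fun k => r (s k)).
  apply: (@independent_comp R r s (fun _ => id)) => //.
  exact: rademacher_independent.
have mS : measurable_fun setT S by apply: measurable_sum => k.
have cosh_bound (v : R) : 0 <= v ->
   ((expR (v `^ (p - 1) / l) + expR (- (v `^ (p - 1) / l))) / 2) ^+ m.+1 <= 2 * expR (v `^ p).
  move=> v0; set x := v `^ (p - 1) / l.
  have := @integral_prod_independent R (fun k => r (s k)) (fun u => expR (x * u)) m.+1 my iy.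
  rewrite (eq_bigr (fun=> ((expR x + expR (- x)) / 2)%:E)); last first.
    by move=> k _; rewrite (integral_rademacher (fun u => expR (x * u))) mulr1 mulrN1.
  rewrite prodEFin prodr_const card_ord => prodE.
  rewrite -lee_fin -prodE; last 3 first.
  - by apply: measurable_expR_comp; apply: measurable_funM.
  - by move=> u; exact: expR_ge0.
  - by move=> n; rewrite (integral_rademacher (fun u => expR (x * u))) ltry.
  apply: (@le_trans _ _ (\int[mu]_t (expR (v `^ p) * (expN p (`|S t| / l) + 1))%:E)%E).
    apply: ge0_le_integral_EFin => [|||t].
    - by apply: measurable_prod => k _; apply: measurable_expR_comp; apply: measurable_funM.
    - apply: measurable_funM => //; apply: measurable_funD => //.
      exact: measurable_expN_div.
    - by move=> t; apply: prodr_ge0 => k _; exact: expR_ge0.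
    - rewrite -expR_sum -mulr_sumr -/(S t) /expN subrK -expRD ler_expR.
      have Sl0 : 0 <= `|S t| / l by rewrite divr_ge0// ltW.
      have := powR_young p1 ltr01 Sl0 v0; rewrite powR1 divr1 mul1r.
      apply: le_trans; rewrite /x mulrAC -mulrA ler_wpM2l ?powR_ge0//.
      by rewrite ler_pM2r ?invr_gt0// ler_norm.
  under eq_integral do rewrite EFinM.
  rewrite ge0_integralZl_EFin ?expR_ge0//; last 2 first.
  - by move=> t _; rewrite lee_fin addr_ge0// expN_ge0.
  - by apply/measurable_EFinP; apply: measurable_funD => //; exact: measurable_expN_div.
  rewrite mulrC EFinM lee_wpmul2l ?lee_fin ?expR_ge0//.
  under eq_integral do rewrite EFinD.
  rewrite ge0_integralD//; last 2 first.
  - by move=> t _; rewrite lee_fin expN_ge0.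
  - by apply/measurable_EFinP; exact: measurable_expN_div.
  by rewrite integral_leb01_cst -[2%:E]/((1 + 1)%:E)%E EFinD leeD2r.
set M : R := m.+1%:R; have M1 : 1 <= M by rewrite /M ler1n.
have sqrt_part : M `^ 2^-1 <= 16 * expR 1 * l.
  have := cosh_bound 1 ler01; rewrite !powR1 mul1r.
  set x := l^-1; have x0 : 0 < x by rewrite invr_gt0.
  move=> h.
  have h1 : 1 + M * (x ^+ 2 / 8) <= 2 * expR 1.
    apply: le_trans h.
    apply: (@le_trans _ _ ((1 + x ^+ 2 / 8) ^+ m.+1)); last first.
      have b0 : 0 <= 1 + x ^+ 2 / 8 by rewrite addr_ge0// divr_ge0// sqr_ge0.
      have hc := cosh_ge (ltW x0).
      by rewrite lerXn2r ?nnegrE// (le_trans b0).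
    have bern (b : R) k : 0 <= b -> 1 + k%:R * b <= (1 + b) ^+ k.
      move=> b0; elim: k => [|k IH]; first by rewrite mul0r addr0 expr0.
      rewrite exprS; apply: (@le_trans _ _ ((1 + b) * (1 + k%:R * b))); last first.
        by rewrite ler_wpM2l// addr_ge0.
      rewrite -natr1; have : 0 <= k%:R * b * b by rewrite !mulr_ge0.
      lra.
    by apply: bern; rewrite divr_ge0// sqr_ge0.
  have h2 : M <= (16 * expR 1) * l ^+ 2.
    have h3 : M * x ^+ 2 <= 16 * expR 1 by lra.
    have := ler_wpM2r (sqr_ge0 l) h3.
    by rewrite -[X in X <= _ -> _]mulrA -exprMn /x mulVf ?gt_eqF// expr1n mulr1.
  rewrite powR12_sqrt; last lra.
  rewrite -(ler_pXn2r (n := 2)) ?nnegrE ?sqrtr_ge0//; last by rewrite mulr_ge0 ?mulr_ge0 ?expR_ge0// ltW.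
  rewrite sqr_sqrtr; last lra.
  apply: (le_trans h2); rewrite exprMn ler_wpM2r ?sqr_ge0// expr2 ler_peMl ?mulr_ge0 ?expR_ge0//.
  lra.
have conj_part : M `^ (1 - p^-1) <= 16 * expR 1 * l.
  have p0 : 0 < p by lra.
  have := cosh_bound (M `^ p^-1) (powR_ge0 _ _).
  rewrite -!powRrM mulVf ?gt_eqF// powRr1; last lra.
  have -> : p^-1 * (p - 1) = 1 - p^-1 by field; rewrite gt_eqF.
  set w := M `^ (1 - p^-1) => h.
  have h1 : (expR (w / l) / expR 1) ^+ m.+1 <= expR 1 * expR M.
    apply: (@le_trans _ _ (2 * expR M)); last by rewrite ler_wpM2r ?expR_ge0.
    apply: le_trans h; rewrite lerXn2r ?nnegrE ?divr_ge0 ?addr_ge0 ?expR_ge0//.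
    rewrite ler_pdivrMr ?expR_gt0//.
    have := expR_ge0 (w / l); have := expR_ge0 (- (w / l)).
    set A := expR (w / l); set B := expR _ => B0 A0.
    have : (A + B) / 2 * 2 <= (A + B) / 2 * expR 1 by rewrite ler_wpM2l// divr_ge0// addr_ge0.
    lra.
  have h2 : w / l - 1 <= 3.
    move: h1; rewrite -expRB -expRM_natl -/M -expRD ler_expR => h1.
    have : M * (w / l - 1) <= M * 2 by lra.
    by rewrite ler_pM2l; lra.
  have : w <= 4 * l by rewrite -ler_pdivrMr//; lra.
  move=> h3; apply: (le_trans h3); rewrite ler_pM2r//; lra.
by rewrite /growth_exp; case: (leP _ (1 - p^-1)).
Qed.

Lemma Gamma_iid_le p q : 1 <= p -> Gamma_iid (expL0 p) q ->
  1 <= q /\ growth_exp p <= q^-1.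
Proof.
move=> p1 [q1 Hq]; split=> //.
have [s si [_ _ /(_ id)]] := Hq r (rademacher_weakly_null p1)
  (@rademacher_independent R) (@rademacher_iid R).
move=> /(_ (fun _ _ => erefl)).
set A := ereal_sup _ => Aoo.
have [M HM] : exists M : R, (A <= M%:E)%E.
  by move: Aoo; case: A => [a| |]// _; [exists a|exists 0; rewrite leNye].
rewrite leNgt; apply/negP => kq.
have d0 : 0 < growth_exp p - q^-1 by lra.
have D0 : 0 < 16 * expR 1 :> R by rewrite mulr_gt0// expR_gt0.
have [m hm] := powR_unbounded (16 * expR 1 * M) d0.
have c0 : 0 < m.+1%:R `^ (- q^-1) :> R by rewrite powR_gt0// ltr0n.
have : ((m.+1%:R `^ (- q^-1))%:E *
   luxemburg_norm (expN p) (fun t => \sum_(k < m.+1) r (s k) t)%R <= M%:E)%E.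
  by apply: le_trans HM; apply: ereal_sup_ubound; exists m.
apply/negP; rewrite -ltNge.
apply: (@lt_le_trans _ _ ((m.+1%:R `^ (- q^-1))%:E *
    (m.+1%:R `^ growth_exp p / (16 * expR 1))%:E)%E); last first.
  rewrite lee_wpmul2l ?lee_fin ?(ltW c0)//.
  apply: le_ereal_inf_tmp => _ [l [l0 hl] <-].
  rewrite lee_fin ler_pdivrMr// mulrC.
  apply: (@rademacher_sum_lower p s m l) => //.
  exact: increasing_seq_injective.
rewrite -EFinM lte_fin mulrA ltr_pdivlMr// -powRD; last first.
  by rewrite pnatr_eq0 implybT.
by rewrite addrC mulrC.
Qed.

End rademacher_sums.

(** * The index sets *)

Lemma Gamma_expL0 (R : realType) (p : R) : 1 <= p ->
  Gamma_iid (expL0 p) = [set q | 1 <= q /\ growth_exp p <= q^-1] /\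
  Gamma_i (expL0 p) = [set q | 1 <= q /\ growth_exp p <= q^-1].
Proof.
move=> p1.
have sub1 q : Gamma_i (expL0 p) q -> Gamma_iid (expL0 p) q.
  by move=> [q1 Hq]; split=> // x wx ix _; exact: Hq.
split; apply/seteqP; split=> q.
- exact: Gamma_iid_le.
- by move=> [q1 qk]; apply: sub1; exact: sub_Gamma_i.
- by move=> /sub1; exact: Gamma_iid_le.
- by move=> [q1 qk]; exact: sub_Gamma_i.
Qed.

Theorem theorem23 (R : realType) :
  (forall p : R, 1 <= p <= 2 ->
     Gamma_iid (expL0 p) = Gamma_i (expL0 p) /\
     Gamma_i (expL0 p) = `[1, 2]%classic) /\
  (forall p : R, 2 <= p ->
     Gamma_iid (expL0 p) = Gamma_i (expL0 p) /\
     Gamma_i (expL0 p) = `[1, p / (p - 1)]%classic).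
Proof.
split=> p.
- move=> /andP[p1 p2]; have [-> ->] := Gamma_expL0 p1; split=> //.
  have -> : growth_exp p = 2^-1.
    rewrite /growth_exp; apply/max_idPl.
    have : 2^-1 <= p^-1 by rewrite lef_pV2 ?posrE//; lra.
    lra.
  apply/seteqP; split=> q /=; rewrite in_itv/=.
    by move=> [q1 h]; rewrite q1/= -lef_pV2 ?posrE//; lra.
  by move=> /andP[q1 q2]; split=> //; rewrite lef_pV2 ?posrE//; lra.
- move=> p2; have p1 : 1 <= p by lra.
  have [-> ->] := Gamma_expL0 p1; split=> //.
  have pp : 1 - p^-1 = (p / (p - 1))^-1.
    by field; rewrite !gt_eqF//; lra.
  have -> : growth_exp p = (p / (p - 1))^-1.
    rewrite -pp /growth_exp; apply/max_idPr.
    have : p^-1 <= 2^-1 by rewrite lef_pV2 ?posrE//; lra.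
    lra.
  have c0 : 0 < p / (p - 1) by rewrite divr_gt0//; lra.
  apply/seteqP; split=> q /=; rewrite in_itv/=.
    by move=> [q1 h]; rewrite q1/= -lef_pV2 ?posrE//; lra.
  by move=> /andP[q1 q2]; split=> //; rewrite lef_pV2 ?posrE//; lra.
Qed.
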